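(* Let $n\ge1$ and let $\chi:\mathcal{H}_n\to\mathbb{K}$ be the trace map sending $h$ to the coefficient of $1$ in the expansion of $h$ in the basis $\{T_w\}_{w\in\mathfrak{S}_n}$. For every partition $\lambda\vdash n$ and every primitive idempotent $E_\lambda$ of $\mathcal{H}_n$ corresponding to $\lambda$, $$\chi(E_\lambda)=q^{n(\lambda)}\prod_{x\in[\lambda]}[h(x)]_q^{-1}.$$ Equivalently, $$\chi=\sum_{\lambda\vdash n}q^{n(\lambda)}\prod_{x\in[\lambda]}[h(x)]_q^{-1}\,\chi^\lambda .$$
   Context: $\mathbb{K}$ is an algebraically closed field of characteristic $0$ and $q\in\mathbb{K}^\times$ satisfies $q^m\neq1$ for all $m>1$; $[m]_q=(q^m-1)/(q-1)$. $\mathcal{H}_n=\mathcal{H}_{q,n}$ is the Hecke algebra with $\mathbb{K}$-basis $\{T_w\mid w\in\mathfrak{S}_n\}$, generated by $T_i=T_{(i,i+1)}$, $1\le i\le n-1$, with the braid relations ($T_iT_{i+1}T_i=T_{i+1}T_iT_{i+1}$, $T_iT_j=T_jT_i$ for $|i-j|>1$) and $T_i^2=(q-1)T_i+q$; $T_w=T_{i_1}\cdots T_{i_l}$ for any reduced expression of $w$, and $T_{\mathrm{id}}=1$. It is semisimple. Its irreducible characters $\chi^\lambda$ are labelled by partitions $\lambda\vdash n$ in the standard way: restriction from $\mathcal{H}_n$ to $\mathcal{H}_{n-1}=\langle T_1,\dots,T_{n-2}\rangle$ is given by removing one node from the diagram, and for $n=2$, $T_1$ acts by $q$ for $(2)$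 and by $-1$ for $(1,1)$. A primitive idempotent $E_\lambda$ corresponds to $\lambda$ if $\chi^\mu(E_\lambda)=\delta_{\lambda\mu}$. $[\lambda]$ is the diagram of $\lambda$ (row $i$ has $\lambda_i$ nodes), $h(x)$ is the hook length of the node $x\in[\lambda]$, and $n(\lambda)=\sum_i(i-1)\lambda_i$. *)

(* Defs.v *)
From HB Require Import structures.
From mathcomp Require Import all_boot all_order all_fingroup all_algebra all_field.

Set Implicit Arguments.
Unset Strict Implicit.
Unset Printing Implicit Defensive.

Import GRing.Theory.
Local Open Scope ring_scope.

(** * Hecke algebras of type A *)

(** The generators are indexed by ['I_n.-1], from 0; [stransp i] exchanges
    [i] and [i.+1] (here [ordS] does not wrap around, since [i < n.-1]). *)
Definition stransp (n : nat) (i : 'I_n.-1) : 'S_n :=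
  let j := widen_ord (leq_pred n) i in tperm j (ordS j).

Definition word_perm (n : nat) (u : seq 'I_n.-1) : 'S_n :=
  (\prod_(i <- u) stransp i)%g.

Definition reduced_word (n : nat) (u : seq 'I_n.-1) : Prop :=
  forall v : seq 'I_n.-1, word_perm v = word_perm u -> (size u <= size v)%N.

(** A model of the Hecke algebra: basis, relations, and the value of the basis
    elements on reduced expressions determine the algebra up to a unique
    isomorphism preserving the [T_w]. MathComp composes permutations from left
    to right; the other convention amounts to relabelling [T_w] as
    [T_(w^-1)], which changes neither the generators nor [T_1]. *)
Record heckeAlgebra (K : fieldType) (q : K) (n : nat) : Type := HeckeAlgebra {
  hecke_alg :> falgType K;
  hecke_T : 'S_n -> hecke_alg;
  hecke_basis : basis_of fullv (codom hecke_T);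
  hecke_T1 : hecke_T 1%g = 1;
  hecke_T_reduced : forall u : seq 'I_n.-1, reduced_word u ->
    hecke_T (word_perm u) = \prod_(i <- u) hecke_T (stransp i);
  hecke_braid : forall i j : 'I_n.-1, j = i.+1 :> nat ->
    hecke_T (stransp i) * hecke_T (stransp j) * hecke_T (stransp i) =
    hecke_T (stransp j) * hecke_T (stransp i) * hecke_T (stransp j);
  hecke_comm : forall i j : 'I_n.-1, (i.+1 < j)%N ->
    hecke_T (stransp i) * hecke_T (stransp j) =
    hecke_T (stransp j) * hecke_T (stransp i);
  hecke_quad : forall i : 'I_n.-1,
    hecke_T (stransp i) ^+ 2 = (q - 1) *: hecke_T (stransp i) + q%:A
}.

Definition hecke_coef (K : fieldType) (q : K) (n : nat) (H : heckeAlgebra q n)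
    (w : 'S_n) (h : H) : K :=
  coord (codom_tuple (@hecke_T K q n H)) (enum_rank w) h.

Definition hecke_trace (K : fieldType) (q : K) (n : nat) (H : heckeAlgebra q n)
    (h : H) : K :=
  hecke_coef 1%g h.

(** The inclusion of [H_n] in [H_(n+1)] as the subalgebra generated by all the
    generators but the last one: [T_w] is sent to [T_w'], where [w'] extends
    [w] by fixing the last point. *)
Definition hecke_incl (K : fieldType) (q : K) (n : nat)
    (H : heckeAlgebra q n) (H' : heckeAlgebra q n.+1) (h : H) : H' :=
  \sum_(w : 'S_n) hecke_coef w h *: hecke_T H' (lift_perm ord_max ord_max w).

(** * Irreducible characters and primitive idempotents *)

(** The subspaces are row spaces, acted upon from the right; irreducibility of
    a matrix representation is insensitive to the side. *)
Definition mx_rep_irreducible (K : fieldType) (A : falgType K) (d : nat)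
    (rho : {lrmorphism A -> 'M[K]_d.+1}) : Prop :=
  forall U : 'M[K]_d.+1,
    (forall a : A, stablemx U (rho a)) -> U != 0 -> row_full U.

Definition irr_character (K : fieldType) (A : falgType K) (f : A -> K) : Prop :=
  exists (d : nat) (rho : {lrmorphism A -> 'M[K]_d.+1}),
    mx_rep_irreducible rho /\ (forall a : A, f a = \tr (rho a)).

Definition primitive_idempotent (R : nzRingType) (e : R) : Prop :=
  [/\ e * e = e, e != 0
    & forall f g : R, f * f = f -> g * g = g -> f * g = 0 -> g * f = 0 ->
        e = f + g -> f = 0 \/ g = 0].

(** * Partitions *)

(** A partition of [n] is its sequence of parts, padded with zeros to
    length [n]. *)
Record intpart (n : nat) : Type := IntPart {
  intpart_val : n.-tuple 'I_n.+1;
  intpartP : sorted geq (map val intpart_val)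
             && (sumn (map val intpart_val) == n)
}.
HB.instance Definition _ (n : nat) := [isSub for @intpart_val n].
HB.instance Definition _ (n : nat) := [Finite of intpart n by <:].

Definition parts (n : nat) (la : intpart n) : seq nat := map val (intpart_val la).

Definition part (n : nat) (la : intpart n) (i : nat) : nat :=
  nth 0%N (parts la) i.

(** Nodes are pairs (row, column), both counted from 0. *)
Definition diagram (n : nat) (la : intpart n) : {set 'I_n * 'I_n} :=
  [set x : 'I_n * 'I_n | (x.2 < part la x.1)%N].

Definition hook (n : nat) (la : intpart n) (x : 'I_n * 'I_n) :
    {set 'I_n * 'I_n} :=
  [set y : 'I_n * 'I_n in diagram la | ((y.1 == x.1) && (x.2 <= y.2)%N)
                      || ((y.2 == x.2) && (x.1 <= y.1)%N)].

Definition hook_length (n : nat) (la : intpart n) (x : 'I_n * 'I_n) : nat :=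
  #|hook la x|.

(** With rows counted from 0, the weight [i - 1] of row [i] becomes [i]. *)
Definition nstat (n : nat) (la : intpart n) : nat :=
  (\sum_(i < n) i * part la i)%N.

Definition remove_node (n : nat) (la : intpart n.+1) (mu : intpart n) : bool :=
  [exists i : 'I_n.+1, [forall j : 'I_n.+1,
     part la j == (part mu j + (j == i))%N]].

(** * The labelling of irreducible characters by partitions *)

(** These conditions determine [chi n] uniquely for [n >= 1]; nothing is
    required of [chi 0]. *)
Record standard_labelling (K : fieldType) (q : K)
    (H : forall n : nat, heckeAlgebra q n)
    (chi : forall n : nat, intpart n -> H n -> K) : Prop := StandardLabelling {
  labelling_irr : forall (n : nat) (la : intpart n), (0 < n)%N ->
    irr_character (chi n la);
  labelling_inj : forall (n : nat) (la mu : intpart n), (0 < n)%N ->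
    chi n la =1 chi n mu -> la = mu;
  labelling_surj : forall (n : nat) (f : H n -> K), (0 < n)%N ->
    irr_character f -> exists la : intpart n, f =1 chi n la;
  labelling_branch : forall (n : nat) (la : intpart n.+1) (h : H n), (0 < n)%N ->
    chi n.+1 la (hecke_incl (H n.+1) h) =
    \sum_(mu : intpart n | remove_node la mu) chi n mu h;
  labelling_row2 : forall la : intpart 2, parts la = [:: 2; 0]%N ->
    chi 2%N la (hecke_T (H 2%N) (@stransp 2 ord0)) = q;
  labelling_col2 : forall la : intpart 2, parts la = [:: 1; 1]%N ->
    chi 2%N la (hecke_T (H 2%N) (@stransp 2 ord0)) = -1
}.

Definition corresponds (K : fieldType) (q : K)
    (H : forall n : nat, heckeAlgebra q n)
    (chi : forall n : nat, intpart n -> H n -> K)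
    (n : nat) (E : H n) (la : intpart n) : Prop :=
  forall mu : intpart n, chi n mu E = (la == mu)%:R.

Definition qint (K : fieldType) (q : K) (m : nat) : K := (q ^+ m - 1) / (q - 1).

(* Main.v *)
Require Import Defs.
From HB Require Import structures.
From mathcomp Require Import all_boot all_order all_fingroup all_algebra all_field.
From mathcomp Require Import zify ring.

Set Implicit Arguments.
Unset Strict Implicit.
Unset Printing Implicit Defensive.

Import GRing.Theory.
Local Open Scope ring_scope.

(** The trace and the weighted sum of the characters are compared on the elements [T_w].
    Every [w] has a normal word [u_1 ... u_m] with [u_k] a descending run of
    generators starting at [k], and [T_w] is the product along it.  The character
    [chi^la] is computed in Young's semi-normal form, where [T_k] acts on standard
    tableaux with diagonal entry [(q - 1) y / (y - x)], [x] and [y] being [q] to the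
    contents of the boxes [k] and [k + 1]; that these representations carry the given
    labels follows from the branching rule, since a partition of [n >= 3] is determined
    by the partitions of [n - 1] below it.  By cyclicity it then suffices that the
    weighted sum [tau] restricts from [H_(n+1)] to [H_n] as [tau] and that
    [tau (h T_n) = 0] for [h] in [H_n].  If [p_x] is the ratio of the weights of
    [mu + node] and [mu], where [x] is [q] to the content of the added node, these say
    [sum_x p_x = 1] and [sum_x p_x x / (x - y) = 0] for every removable node of [mu],
    [y] being [q] to its content; with Frobenius' form of the hook formula both are
    cases of Lagrange's identity [sum_i f(z_i) / prod_(j != i) (z_i - z_j) = 0]. *)

(** * Normal words in the braid generators *)

(** The labels are known only through restriction, so a semi-normal module must be shown irreducible
    before it can receive a label at all. Both irreducibility and the identification of the label
    rest on the Jucys-Murphy elements: their eigenvalues, [q] to the contents, separate all standard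
    tableaux of one size, whatever their shapes, so some element of the algebra acts as one diagonal
    matrix unit in a single shape and as 0 in the others. It projects onto a coordinate line in the
    irreducibility proof and detects one shape in the branching rule. Size 2 is a base case of its
    own because (2) and (1,1) restrict alike. The trace argument lives on words: generators act on
    functions of tableaux, restriction is removal of the head of a list, and a normal word contains
    the top generator at most once, so a cyclic shift can make it last. Lagrange's identity enters
    because adding a node in row [i] multiplies [z_i], which is [q] to the [i]-th beta-number, by
    [q] and fixes the other [z_j], so that a ratio of weights is essentially a product of
    [(q z_i - z_j) / (z_i - z_j)]. *)

Definition braided (M : Type) (idx : M) (op : Monoid.law idx) (g : nat -> M)
    (N : nat) : Prop :=
  (forall i, (i.+1 < N)%N ->
     op (op (g i) (g i.+1)) (g i) = op (op (g i.+1) (g i)) (g i.+1)) /\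
  (forall i j, (i.+1 < j)%N -> (j < N)%N -> op (g i) (g j) = op (g j) (g i)).

(** Quantifying over all monoids lets the same rewriting of words be used in
    the symmetric group, in the Hecke algebra and in a matrix algebra. *)
Definition braid_equiv (N : nat) (u v : seq nat) : Prop :=
  size u = size v /\
  forall (M : Type) (idx : M) (op : Monoid.law idx) (g : nat -> M),
    braided op g N -> \big[op/idx]_(i <- u) g i = \big[op/idx]_(i <- v) g i.

Lemma braid_equiv_refl N u : braid_equiv N u u.
Proof. by []. Qed.

Lemma braid_equiv_sym N u v : braid_equiv N u v -> braid_equiv N v u.
Proof. by case=> eq_sz eq_uv; split=> // M idx op g br; rewrite eq_uv. Qed.

Lemma braid_equiv_trans N u v w :
  braid_equiv N u v -> braid_equiv N v w -> braid_equiv N u w.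
Proof.
case=> sz_uv eq_uv [sz_vw eq_vw]; split=> [|M idx op g br].
  by rewrite sz_uv.
by rewrite eq_uv ?eq_vw.
Qed.

Lemma braid_equiv_cat N u u' v v' :
  braid_equiv N u u' -> braid_equiv N v v' -> braid_equiv N (u ++ v) (u' ++ v').
Proof.
case=> sz_u eq_u [sz_v eq_v]; split=> [|M idx op g br].
  by rewrite !size_cat sz_u sz_v.
by rewrite !big_cat /= eq_u ?eq_v.
Qed.

Lemma braidedS M idx (op : @Monoid.law M idx) g N :
  braided op g N.+1 -> braided op g N.
Proof.
case=> br cm; split=> [i ltiN | i j ltij ltjN]; first by apply: br; lia.
by apply: cm => //; lia.
Qed.

Lemma braid_equivS N u v : braid_equiv N u v -> braid_equiv N.+1 u v.
Proof.
by case=> sz_uv eq_uv; split=> // M idx op g br; apply: eq_uv; apply: braidedS.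
Qed.

Lemma braid_equiv_comm N i u : (i < N)%N ->
  all (fun k => (k < N)%N && ((i.+1 < k)%N || (k.+1 < i)%N)) u ->
  braid_equiv N (u ++ [:: i]) (i :: u).
Proof.
move=> ltiN; elim: u => [|k u IHu] /=; first by [].
case/andP=> /andP[ltkN far] all_u.
have: braid_equiv N (k :: u ++ [:: i]) (k :: i :: u).
  exact: (braid_equiv_cat (u := [:: k]) (u' := [:: k]) _ (IHu all_u)).
move/braid_equiv_trans; apply.
apply: (braid_equiv_cat (u := [:: k; i]) (u' := [:: i; k]) _
  (braid_equiv_refl N u)).
split=> // M idx op g [_ cm].
rewrite !big_cons big_nil !Monoid.mulm1 /=.
by case/orP: far => [lt_ik | lt_ki]; [rewrite (cm i k) | rewrite (cm k i)].
Qed.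

(** The word [N; N - 1; ...; j], empty for [j = N + 1]. *)
Definition descent (N j : nat) : seq nat := rev (iota j (N.+1 - j)).

Lemma mem_descent N j k : (k \in descent N j) = (j <= k <= N)%N.
Proof. rewrite mem_rev mem_iota; lia. Qed.

Lemma descent_nil N : descent N N.+1 = [::].
Proof. by rewrite /descent subnn. Qed.

Lemma descent_rcons N j : (j <= N)%N ->
  descent N j = descent N j.+1 ++ [:: j].
Proof. by move=> lejN; rewrite /descent subSn //= rev_cons subSS cats1. Qed.

Lemma descent_cat N i j : (j <= i)%N -> (i <= N.+1)%N ->
  descent N j = descent N i ++ rev (iota j (i - j)).
Proof.
move=> leji leiN; rewrite /descent -rev_cat; congr rev.
have -> : (N.+1 - j = (i - j) + (N.+1 - i))%N by lia.
by rewrite iotaD; congr (_ ++ iota _ _); lia.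
Qed.

Lemma descent_cons N j : (j <= N)%N ->
  descent N j = N :: rev (iota j (N - j)).
Proof. by move=> lejN; rewrite (descent_cat lejN) // /descent subSnn. Qed.

Lemma descent_comm N i j : (i.+1 < j)%N -> (j <= N.+1)%N ->
  braid_equiv N.+1 (descent N j ++ [:: i]) (i :: descent N j).
Proof.
move=> ltij lejN; apply: braid_equiv_comm; first by lia.
by apply/allP=> k; rewrite mem_descent; lia.
Qed.

(** The letter [i.+1] passes everything below [i], one braid move turns [i.+1, i, i.+1] into
    [i, i.+1, i], and the resulting [i] passes everything above [i.+1]. *)
Lemma descent_shift N i j : (j <= i)%N -> (i < N)%N ->
  braid_equiv N.+1 (descent N j ++ [:: i.+1]) (i :: descent N j).
Proof.
move=> leji ltiN; have leiN : (i.+2 <= N.+1)%N by lia.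
rewrite (@descent_cat N i.+2 j) //; last by lia.
have -> : (i.+2 - j = (i - j) + 2)%N by lia.
rewrite iotaD rev_cat (subnKC leji).
have -> : rev (iota i 2) = [:: i.+1; i] by [].
set A := descent _ _; set B := rev _.
have commB : braid_equiv N.+1 (B ++ [:: i.+1]) (i.+1 :: B).
  apply: braid_equiv_comm; first by lia.
  by apply/allP=> k; rewrite mem_rev mem_iota; lia.
have commA : braid_equiv N.+1 (A ++ [:: i]) (i :: A).
  apply: braid_equiv_comm; first by lia.
  by apply/allP=> k; rewrite mem_descent; lia.
have brd : braid_equiv N.+1 [:: i.+1; i; i.+1] [:: i; i.+1; i].
  split=> // M idx op g [br _].
  rewrite !big_cons !big_nil !Monoid.mulm1 /= !Monoid.mulmA.
  exact/esym/br.
rewrite -!catA.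
apply: (braid_equiv_trans (v := A ++ [:: i.+1; i; i.+1] ++ B)).
  rewrite -[[:: i.+1; i; i.+1] ++ B]/([:: i.+1; i] ++ (i.+1 :: B)).
  by do 2!apply: braid_equiv_cat => //.
apply: (braid_equiv_trans (v := A ++ [:: i; i.+1; i] ++ B)).
  by do 2!apply: braid_equiv_cat => //.
rewrite -[[:: i; i.+1; i] ++ B]/([:: i] ++ ([:: i.+1; i] ++ B)) catA.
exact: (braid_equiv_cat (u' := i :: A)).
Qed.

Fixpoint normal_words (N : nat) : seq (seq nat) :=
  if N is N'.+1 then
    [seq u ++ descent N' j | u <- normal_words N', j <- iota 0 N.+1]
  else [:: [::]].

Lemma normal_wordsSP N v :
  reflect (exists u j, [/\ u \in normal_words N, (j <= N.+1)%N
                         & v = u ++ descent N j])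
          (v \in normal_words N.+1).
Proof.
apply: (iffP allpairsP) => [[[u j] [Nu Nj ->]] | [u [j [Nu Nj ->]]]].
  by exists u, j; split=> //; rewrite mem_iota /= in Nj; lia.
by exists (u, j); split=> //; rewrite mem_iota /=; lia.
Qed.

Lemma nil_normal N : [::] \in normal_words N.
Proof.
elim: N => // N IHN; apply/normal_wordsSP; exists [::], N.+1.
by rewrite descent_nil.
Qed.

Lemma normal_wordsS N v : v \in normal_words N -> v \in normal_words N.+1.
Proof.
move=> Nv; apply/normal_wordsSP; exists v, N.+1.
by rewrite descent_nil cats0.
Qed.

Lemma normal_words_lt N v : v \in normal_words N -> all (fun k => (k < N)%N) v.
Proof.
elim: N v => [|N IHN] v; first by rewrite inE => /eqP->.
case/normal_wordsSP=> u [j [/IHN/allP Nu _ ->]]; rewrite all_cat.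
apply/andP; split; apply/allP=> k; last by rewrite mem_descent; lia.
by move/Nu; lia.
Qed.

Lemma size_normal_words N : size (normal_words N) = (N.+1)`!.
Proof.
elim: N => // N IHN; rewrite size_allpairs /= size_iota IHN.
by rewrite (factS N.+1) mulnC.
Qed.

(** The exchange condition by braid moves alone, so that it can be combined with either quadratic
    relation, that of the group or that of the Hecke algebra. Let [j] be the end of the last run.
    The letter [j - 1] lengthens the run and [j] shortens it; any other letter slides through,
    lowered by one if it exceeds [j], and meets the shorter normal word. *)
Lemma normal_exchange N v i : v \in normal_words N -> (i < N)%N ->
  (exists2 v', v' \in normal_words N & braid_equiv N (v ++ [:: i]) v') \/
  (exists2 v', v' \in normal_words N & braid_equiv N v (v' ++ [:: i])).
Proof.
elim: N v i => // N IHN v i /normal_wordsSP[u [j [Nu lejN ->]]] ltiN.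
have slide k : (k < N)%N ->
    braid_equiv N.+1 (descent N j ++ [:: i]) (k :: descent N j) ->
    (exists2 v', v' \in normal_words N.+1
       & braid_equiv N.+1 ((u ++ descent N j) ++ [:: i]) v') \/
    (exists2 v', v' \in normal_words N.+1
       & braid_equiv N.+1 (u ++ descent N j) (v' ++ [:: i])).
  move=> ltkN eq_i.
  case: (IHN u k Nu ltkN) => -[u' Nu' /braid_equivS eq_u']; [left|right].
    exists (u' ++ descent N j); first by apply/normal_wordsSP; exists u', j.
    rewrite -catA; apply: (braid_equiv_trans (v := u ++ (k :: descent N j))).
      exact: braid_equiv_cat.
    by rewrite -[k :: _]/([:: k] ++ _) catA; apply: braid_equiv_cat.
  exists (u' ++ descent N j); first by apply/normal_wordsSP; exists u', j.
  apply: (braid_equiv_trans (v := (u' ++ [:: k]) ++ descent N j)).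
    exact: braid_equiv_cat.
  by rewrite -!catA; apply: braid_equiv_cat => //; apply: braid_equiv_sym.
case: (ltngtP i j) => [ltij | ltji | eqij].
- move: ltij; rewrite leq_eqVlt => /predU1P[eqi1j | lti1j]; last first.
    by apply: (slide i); [lia | apply: descent_comm].
  left; exists (u ++ descent N i).
    by apply/normal_wordsSP; exists u, i; split=> //; lia.
  by rewrite -eqi1j (@descent_rcons N i) ?catA //; lia.
- case: i ltiN ltji slide => // i ltiN leji slide.
  by apply: (slide i) => //; apply: descent_shift.
right; exists (u ++ descent N j.+1).
  by apply/normal_wordsSP; exists u, j.+1; split=> //; lia.
by rewrite eqij descent_rcons ?catA //; lia.
Qed.

(** * The symmetric group *)

(** The neutral element at letters out of range matches [pmap insub], which drops them. *)
Definition gen_at (M : Type) (idx : M) (N : nat) (f : 'I_N -> M) (k : nat) : M :=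
  oapp f idx (insub k).

Lemma gen_atE M (idx : M) N (f : 'I_N -> M) k (ltkN : (k < N)%N) :
  gen_at idx f k = f (Ordinal ltkN).
Proof. by rewrite /gen_at insubT. Qed.

Lemma prod_pmap_insub M (idx : M) (op : Monoid.law idx) N (f : 'I_N -> M) u :
  \big[op/idx]_(i <- pmap insub u) f i = \big[op/idx]_(k <- u) gen_at idx f k.
Proof.
elim: u => [|k u IHu] /=; first by rewrite !big_nil.
rewrite big_cons /gen_at; case: insub => [i|] /=; rewrite -IHu ?big_cons //.
by rewrite Monoid.mul1m.
Qed.

Definition sgen (N k : nat) : 'S_N.+1 := gen_at 1%g (@stransp N.+1) k.

Definition perm_of_word (N : nat) (u : seq nat) : 'S_N.+1 := (\prod_(k <- u) sgen N k)%g.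

Lemma sgenE N k : (k < N)%N -> sgen N k = tperm (inord k) (inord k.+1).
Proof.
move=> ltkN; rewrite /sgen (gen_atE _ _ ltkN) /stransp.
by congr tperm; apply/val_inj; rewrite /= !inordK ?modn_small //; lia.
Qed.

Lemma inord_eq N i j : (i <= N)%N -> (j <= N)%N ->
  (inord i == inord j :> 'I_N.+1) = (i == j).
Proof. by move=> leiN lejN; rewrite -val_eqE /= !inordK. Qed.

Lemma sgenD N k (p : nat) : (k < N)%N -> (p <= N)%N -> (p < k)%N || (k.+1 < p)%N ->
  sgen N k (inord p) = inord p.
Proof. by move=> ltkN lepN far; rewrite sgenE // tpermD // inord_eq; lia. Qed.

Lemma sgen_braided N : braided mulg (sgen N) N.
Proof.
have conjE k x : (k < N)%N -> (sgen N k * x * sgen N k = x ^ sgen N k)%g.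
  by move=> ltkN; rewrite /conjg sgenE // tpermV mulgA.
split=> [i ltiN | i j ltij ltjN] /=.
  rewrite !conjE //; last by lia.
  rewrite !(@sgenE _ i) ?(@sgenE _ i.+1) //; last by lia.
  rewrite !tpermJ tpermR tpermL [tperm (inord i) _ _]tpermD ?inord_eq //; try lia.
  by rewrite [tperm (inord i.+1) _ _]tpermD ?inord_eq //; lia.
apply/commgP/conjg_fixP; rewrite (@sgenE _ i); last by lia.
by rewrite tpermJ !sgenD //; lia.
Qed.

Lemma sgen_sq N k : (sgen N k * sgen N k = 1)%g.
Proof.
by rewrite /sgen /gen_at; case: insub => [i|] /=; rewrite ?mulg1 // tperm2.
Qed.

Lemma perm_of_word_cat N u v : perm_of_word N (u ++ v) =
  (perm_of_word N u * perm_of_word N v)%g.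
Proof. by rewrite /perm_of_word big_cat. Qed.

Lemma perm_of_word1 N k : perm_of_word N [:: k] = sgen N k.
Proof. by rewrite /perm_of_word big_seq1. Qed.

Lemma perm_of_word_fix N M u p : all (fun k => (k < M)%N) u -> (M < p)%N -> (p <= N)%N ->
  perm_of_word N u (inord p) = inord p.
Proof.
move=> + ltMp lepN; elim: u => [|k u IHu] /=; first by rewrite /perm_of_word big_nil perm1.
case/andP=> ltkM /IHu; rewrite -cat1s perm_of_word_cat perm_of_word1 permM.
by rewrite sgenD //; lia.
Qed.

Lemma perm_of_word_descent N M j : (M < N)%N -> (j <= M.+1)%N ->
  perm_of_word N (descent M j) (inord M.+1) = inord j.
Proof.
move=> ltMN lejM; rewrite -(subKn lejM); move: (M.+1 - j)%N (leq_subr j M.+1).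
elim=> [|d IHd] ledM; first by rewrite subn0 descent_nil /perm_of_word big_nil perm1.
rewrite descent_rcons; last by lia.
have -> : (M.+1 - d.+1).+1 = (M.+1 - d)%N by lia.
rewrite perm_of_word_cat permM IHd ?perm_of_word1 ?sgenE; try lia.
have -> : (M.+1 - d.+1).+1 = (M.+1 - d)%N by lia.
by rewrite tpermR.
Qed.

(** The last run can be read off the permutation: the letters before it fix the point [M.+1], which
    the run then sends to [j]. Cancelling the run leaves the shorter normal words. *)
Lemma perm_of_word_inj N M : (M <= N)%N ->
  uniq (normal_words M) /\ {in normal_words M &, injective (perm_of_word N)}.
Proof.
elim: M => [_|M IHM ltMN].
  by split=> // u v; rewrite !inE => /eqP-> /eqP->.
have [uniqM injM] := IHM (ltnW ltMN).
have inj u j u' j' : u \in normal_words M -> u' \in normal_words M ->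
    (j <= M.+1)%N -> (j' <= M.+1)%N ->
    perm_of_word N (u ++ descent M j) = perm_of_word N (u' ++ descent M j') ->
    u = u' /\ j = j'.
  move=> Mu Mu' lej lej' eq_uu'.
  have eqj : j = j'.
    move/permP/(_ (inord M.+1)): (eq_uu').
    rewrite !perm_of_word_cat !permM (@perm_of_word_fix _ M u) ?normal_words_lt //.
    rewrite (@perm_of_word_fix _ M u') ?normal_words_lt // !perm_of_word_descent // => /eqP.
    by rewrite inord_eq; lia.
  split=> //; apply: injM => //.
  by move: eq_uu'; rewrite eqj !perm_of_word_cat => /mulIg.
split.
  apply: allpairs_uniq; rewrite ?iota_uniq //.
  move=> [u j] [u' j'] /allpairsP[[u1 j1] [Mu Mj [-> ->]]].
  move=> /allpairsP[[u1' j1'] [Mu' Mj' [-> ->]]] /= eq_uu'.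
  rewrite mem_iota /= in Mj; rewrite mem_iota /= in Mj'.
  by have /= [|| <- <-] := inj _ _ _ _ Mu Mu' _ _ (congr1 (perm_of_word N) eq_uu');
    [lia | lia |].
move=> v v' /normal_wordsSP[u [j [Mu lej ->]]].
by move=> /normal_wordsSP[u' [j' [Mu' lej' ->]]] /inj[] // -> ->.
Qed.

Definition normal_word (N : nat) (w : 'S_N.+1) : seq nat :=
  nth [::] (normal_words N)
    (find (fun v => perm_of_word N v == w) (normal_words N)).

(** There are as many normal words as permutations, so injectivity gives surjectivity. *)
Lemma normal_wordP N (w : 'S_N.+1) :
  normal_word w \in normal_words N /\ perm_of_word N (normal_word w) = w.
Proof.
have [uniqN injN] := perm_of_word_inj (leqnn N).
have uniq_map : uniq (map (perm_of_word N) (normal_words N)) by rewrite map_inj_in_uniq.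
have : w \in map (perm_of_word N) (normal_words N).
  have eq_card : #|map (perm_of_word N) (normal_words N)| = #|[set: 'S_N.+1]|.
    by rewrite (card_uniqP uniq_map) size_map size_normal_words cardsT card_Sn.
  by rewrite (subset_cardP eq_card (introT subsetP _)) ?inE // => x; rewrite inE.
case/mapP=> v Nv eq_w.
have has_w : has (fun v => perm_of_word N v == w) (normal_words N).
  by apply/hasP; exists v; rewrite // eq_w.
by split; [rewrite mem_nth // -has_find | apply/eqP/(nth_find [::] has_w)].
Qed.

Lemma normal_wordK N v : v \in normal_words N -> normal_word (perm_of_word N v) = v.
Proof.
have [_ injN] := perm_of_word_inj (leqnn N).
by have [? ?] := normal_wordP (perm_of_word N v); move=> Nv; apply: injN.
Qed.

Lemma normal_shorten N u : all (fun k => (k < N)%N) u ->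
  exists2 v, v \in normal_words N & (size v <= size u)%N /\ perm_of_word N v =
    perm_of_word N u.
Proof.
elim/last_ind: u => [|u k IHu]; first by exists [::]; rewrite ?nil_normal.
rewrite all_rcons => /andP[ltkN /IHu[v Nv [le_vu eq_vu]]].
have [] := normal_exchange Nv ltkN => -[v' Nv' [sz_v' /(_ _ _ _ _ (sgen_braided N)) eq_v']];
  exists v' => //; rewrite size_rcons; rewrite size_cat /= addn1 in sz_v'.
  split; first by rewrite -sz_v' ltnS.
  by rewrite -cats1 perm_of_word_cat -eq_vu -perm_of_word_cat /perm_of_word eq_v'.
split; first by rewrite leqW // ltnW // -sz_v'.
rewrite -cats1 perm_of_word_cat -eq_vu {2}/perm_of_word eq_v' -/(perm_of_word _ _).
by rewrite perm_of_word_cat perm_of_word1 -mulgA sgen_sq mulg1.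
Qed.

Lemma word_perm_pmap N u :
  @word_perm N.+1 (pmap insub u) = perm_of_word N u.
Proof. exact: prod_pmap_insub. Qed.

(** Any word for the same permutation contracts to a normal word that is no longer, and by
    injectivity this one is [v]. *)
Lemma normal_reduced N v : v \in normal_words N ->
  @reduced_word N.+1 (pmap insub v).
Proof.
move=> Nv u; rewrite word_perm_pmap => eq_uv.
have uE : u = pmap insub (map val u) by rewrite (map_pK valK).
have all_u : all (fun k => (k < N)%N) (map val u) by apply/allP=> _ /mapP[i _ ->];
  exact: ltn_ord.
have [v' Nv' [le_v'u eq_v'u]] := normal_shorten all_u.
have eq_vv' : v' = v.
  have [_ injN] := perm_of_word_inj (leqnn N); apply: injN => //.
  by rewrite eq_v'u -word_perm_pmap -uE.
rewrite size_pmap_sub; apply: leq_trans (count_size _ _) _.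
by rewrite -eq_vv' (leq_trans le_v'u) ?size_map.
Qed.

Lemma lift_perm_stransp N (i : 'I_N) :
  lift_perm ord_max ord_max (@stransp N.+1 i) = sgen N.+1 i.
Proof.
rewrite sgenE; last by rewrite ltnS ltnW.
apply/permP=> x; rewrite /stransp.
have <- : lift ord_max (widen_ord (leq_pred N.+1) i) = inord i.
  by apply/val_inj; rewrite /= /bump inordK; have := ltn_ord i; lia.
have <- : lift ord_max (ordS (widen_ord (leq_pred N.+1) i)) = inord i.+1.
  apply/val_inj; rewrite /= /bump inordK; last by have := ltn_ord i; lia.
  by rewrite modn_small; have := ltn_ord i; lia.
case: (unliftP ord_max x) => [y ->|->]; last first.
  by rewrite lift_perm_id tpermD // eq_sym neq_lift.
rewrite lift_perm_lift; case: (tpermP _ _ y) => [->|->|/eqP ne1 /eqP ne2].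
- by rewrite tpermL.
- by rewrite tpermR.
by rewrite tpermD // (inj_eq (@lift_inj _ _)) eq_sym.
Qed.

Lemma lift_perm_of_word N u : all (fun k => (k < N)%N) u ->
  lift_perm ord_max ord_max (perm_of_word N u) = perm_of_word N.+1 u.
Proof.
elim: u => [_|k u IHu /=]; first by rewrite /perm_of_word !big_nil lift_perm1.
case/andP=> ltkN /IHu IH; rewrite -cat1s !perm_of_word_cat -IH !perm_of_word1.
rewrite -(lift_permM _ ord_max) {1}/sgen (gen_atE _ _ ltkN).
by rewrite lift_perm_stransp.
Qed.

(** * Hecke algebras *)

Section Hecke.
Variables (K : fieldType) (q : K) (N : nat) (H : heckeAlgebra q N.+1).

Definition hgen (k : nat) : H :=
  gen_at 1 (fun i : 'I_N => hecke_T H (@stransp N.+1 i)) k.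

Lemma hgen_braided : braided *%R hgen N.
Proof.
split=> [i ltiN | i j ltij ltjN] /=; rewrite /hgen.
  by rewrite !(gen_atE _ _ ltiN) !(gen_atE _ _ (ltnW ltiN)) hecke_braid.
have ltiN : (i < N)%N by lia.
by rewrite !(gen_atE _ _ ltiN) !(gen_atE _ _ ltjN) hecke_comm.
Qed.

Lemma hgen_quad k : (k < N)%N -> hgen k * hgen k = (q - 1) *: hgen k + q%:A.
Proof. by move=> ltkN; rewrite /hgen (gen_atE _ _ ltkN) -hecke_quad expr2. Qed.

Lemma hecke_T_normal v : v \in normal_words N ->
  hecke_T H (perm_of_word N v) = \prod_(k <- v) hgen k.
Proof.
move=> Nv; have := hecke_T_reduced H (normal_reduced Nv).
by rewrite word_perm_pmap prod_pmap_insub.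
Qed.

Lemma hecke_T_word w : hecke_T H w = \prod_(k <- normal_word w) hgen k.
Proof. by have [Nw {1}<-] := normal_wordP w; apply: hecke_T_normal. Qed.

Lemma hecke_coef_T w w' : hecke_coef w (hecke_T H w') = (w' == w)%:R.
Proof.
rewrite /hecke_coef.
have -> : hecke_T H w' = (codom_tuple (@hecke_T K q N.+1 H))`_(enum_rank w').
  rewrite /= (nth_map w') ?nth_enum_rank //.
  by rewrite -cardE; apply: ltn_ord.
rewrite coord_free ?(inj_eq enum_rank_inj) //.
exact: basis_free (hecke_basis H).
Qed.

Lemma hecke_coef_linear w : linear (@hecke_coef K q N.+1 H w : H -> K^o).
Proof. by move=> a x y; rewrite /hecke_coef linearP. Qed.

Lemma hecke_expand h :
  h = \sum_(w : 'S_N.+1) hecke_coef w h *: \prod_(k <- normal_word w) hgen k.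
Proof.
have b_T : basis_of fullv (codom_tuple (@hecke_T K q N.+1 H)) := hecke_basis H.
rewrite {1}(coord_basis b_T (memvf h)) (reindex enum_rank) /=;
  last exact: (onW_bij _ (@enum_rank_bij _)).
apply: eq_bigr => w _; congr (_ *: _); rewrite -hecke_T_word.
rewrite /= (nth_map w) ?nth_enum_rank //.
by rewrite -cardE; apply: ltn_ord.
Qed.

Lemma hecke_trace_normal v : v \in normal_words N ->
  hecke_trace (\prod_(k <- v) hgen k) = (v == [::])%:R.
Proof.
move=> Nv; rewrite -hecke_T_normal // /hecke_trace hecke_coef_T; congr (_%:R).
have [_ injN] := perm_of_word_inj (leqnn N).
have -> : 1%g = perm_of_word N [::] by rewrite /perm_of_word big_nil.
by rewrite (inj_in_eq injN) // nil_normal.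
Qed.

(** The universal property of the presentation, recovered from the basis: the map is defined
    linearly along normal words, and compatibility with right multiplication by one generator
    implies multiplicativity. *)
Lemma hecke_lrmorphism (A : algType K) (m : nat -> A) :
    braided *%R m N ->
    (forall k, (k < N)%N -> m k * m k = (q - 1) *: m k + q%:A) ->
  exists rho : {lrmorphism H -> A}, forall k, (k < N)%N -> rho (hgen k) = m k.
Proof.
move=> br_m quad_m.
pose f (h : H) : A := \sum_w hecke_coef w h *: \prod_(k <- @normal_word N w) m k.
have f_lin : linear f.
  move=> a x y; rewrite /f scaler_sumr -big_split /=; apply: eq_bigr => w _.
  by rewrite hecke_coef_linear /= scalerDl scalerA.
have [fL fE] : exists g : {linear H -> A}, g =1 f.
  pose fL : {linear H -> A} := HB.pack f (GRing.isLinear.Build K H A *:%R f f_lin).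
  by exists fL.
have f_normal v : v \in normal_words N -> fL (\prod_(k <- v) hgen k) = \prod_(k <- v) m k.
  move=> Nv; rewrite -hecke_T_normal // fE /f (bigD1 (perm_of_word N v)) //=.
  rewrite hecke_coef_T eqxx scale1r normal_wordK // [X in _ + X]big1 ?addr0 // => w.
  by rewrite hecke_coef_T eq_sym => /negPf->; rewrite scale0r.
have f_gen h k : (k < N)%N -> fL (h * hgen k) = fL h * m k.
  move=> ltkN; rewrite [h in RHS]hecke_expand {1}(hecke_expand h).
  rewrite mulr_suml !linear_sum mulr_suml; apply: eq_bigr => w _.
  rewrite -scalerAl !linearZ /= -scalerAl; congr (_ *: _).
  have [Nw _] := normal_wordP w; move: (normal_word w) Nw => v Nv.
  have [] := normal_exchange Nv ltkN => -[v' Nv' [_ eq_v']].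
    have := eq_v' _ _ _ _ hgen_braided; rewrite big_cat big_seq1 /= => ->.
    have := eq_v' _ _ _ _ br_m; rewrite big_cat big_seq1 /= => eqm.
    by rewrite !f_normal // eqm.
  (* Here [v] ends in [k] up to braid moves, so the quadratic relation is applied in [H] and in [A]
     alike. *)
  have eqH := eq_v' _ _ _ _ hgen_braided; have eqA := eq_v' _ _ _ _ br_m.
  rewrite !big_cat !big_seq1 /= in eqH eqA.
  rewrite f_normal // eqA -mulrA quad_m // mulrDr -scalerAr -eqA -scalerAr mulr1.
  rewrite {1}eqH -mulrA hgen_quad // mulrDr -scalerAr -eqH -scalerAr mulr1.
  by rewrite linearD !linearZ /= !f_normal.
have f_word h v : all (fun k => (k < N)%N) v ->
    fL (h * \prod_(k <- v) hgen k) = fL h * \prod_(k <- v) m k.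
  elim/last_ind: v => [|v k IHv]; first by rewrite !big_nil !mulr1.
  rewrite all_rcons => /andP[ltkN /IHv eq_v].
  by rewrite -cats1 !big_cat !big_seq1 /= !mulrA f_gen // eq_v.
have f1 : fL 1 = 1 by have := f_normal [::] (nil_normal N); rewrite !big_nil.
have fM : {morph fL : x y / x * y}.
  move=> x y; rewrite [y in RHS]hecke_expand {1}(hecke_expand y).
  rewrite mulr_sumr !linear_sum mulr_sumr; apply: eq_bigr => w _.
  rewrite -scalerAr !linearZ /= -scalerAr; congr (_ *: _).
  have [Nw _] := normal_wordP w.
  by rewrite f_word ?f_normal //; apply: normal_words_lt.
pose fR : {lrmorphism H -> A} := HB.pack (GRing.Linear.sort fL) fL
  (GRing.isMonoidMorphism.Build H A fL (conj f1 fM)).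
exists fR => k ltkN; have := f_word 1 [:: k]; rewrite !big_seq1 f1 !mul1r /=.
by rewrite andbT; apply.
Qed.

End Hecke.

(** Normal words stay normal when a generator is added, so the inclusion preserves products along
    them. *)
Lemma hecke_inclE (K : fieldType) (q : K) N
    (H : heckeAlgebra q N.+1) (H' : heckeAlgebra q N.+2) h :
  hecke_incl H' h =
  \sum_(w : 'S_N.+1) hecke_coef (H := H) w h *: \prod_(k <- normal_word w) hgen H' k.
Proof.
apply: eq_bigr => w _; congr (_ *: _); have [Nw {1}<-] := normal_wordP w.
by rewrite lift_perm_of_word ?normal_words_lt // hecke_T_normal ?normal_wordsS.
Qed.

Lemma hecke_incl1 (K : fieldType) (q : K) N
    (H : heckeAlgebra q N.+1) (H' : heckeAlgebra q N.+2) :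
  hecke_incl H' (1 : H) = 1.
Proof.
rewrite -{1}(hecke_T1 H) /hecke_incl (bigD1 1%g) //= hecke_coef_T eqxx scale1r.
rewrite lift_perm1 (hecke_T1 H') big1 ?addr0 // => w.
by rewrite hecke_coef_T eq_sym => /negPf->; rewrite scale0r.
Qed.

(** * Standard tableaux as words *)

(** A tableau is recorded by the rows of its boxes, the last box first. *)
Fixpoint std_word (t : seq nat) : bool :=
  if t is i :: r then
    std_word r && ((i == 0) || (count_mem i r < count_mem i.-1 r))%N
  else true.

(** Exchanges the boxes [k] and [k + 1], numbered from 0. *)
Fixpoint swap_box (k : nat) (t : seq nat) : seq nat :=
  if t is i :: r then
    if size r == k.+1 then (if r is j :: r' then j :: i :: r' else t)
    else i :: swap_box k r
  else [::].

Lemma perm_swap_box k t : perm_eq (swap_box k t) t.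
Proof.
elim: t => //= i r IHr; case: ifP => _; last by rewrite perm_cons.
by case: r {IHr} => // j r; rewrite (perm_catCA [:: j] [:: i] r).
Qed.

Lemma size_swap_box k t : size (swap_box k t) = size t.
Proof. exact/perm_size/perm_swap_box. Qed.

Lemma count_swap_box k t a : count a (swap_box k t) = count a t.
Proof. exact/seq.permP/perm_swap_box. Qed.

Lemma swap_boxK k : involutive (swap_box k).
Proof.
elim=> //= i r IHr; case: (boolP (size r == k.+1)) => [szr | /negPf szr].
  by case: r szr {IHr} => //= j r ->.
by rewrite /= size_swap_box szr IHr.
Qed.

Lemma swap_box_cons k i r : (k.+1 < size r)%N ->
  swap_box k (i :: r) = i :: swap_box k r.
Proof. by move=> ltkr /=; case: eqP => // szr; rewrite szr ltnn in ltkr. Qed.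

Lemma swap_box_head k i j r : size r = k ->
  swap_box k (i :: j :: r) = j :: i :: r.
Proof. by move=> <- /=; rewrite eqxx. Qed.

Lemma swap_box_comm k l t : (k.+1 < l)%N -> (l.+1 < size t)%N ->
  swap_box k (swap_box l t) = swap_box l (swap_box k t).
Proof.
move=> ltkl; elim: t => // i r IHr; rewrite [size _]/= ltnS leq_eqVlt.
case/predU1P=> [szr | ltlr]; last first.
  by rewrite !swap_box_cons ?size_swap_box ?IHr //; lia.
case: r szr {IHr} => // j r [szr].
rewrite (swap_box_head _ _ (esym szr)) !(@swap_box_cons k) -?szr ?swap_box_head
  ?size_swap_box //=; lia.
Qed.

Lemma swap_box_braid k t : (k.+2 < size t)%N ->
  swap_box k (swap_box k.+1 (swap_box k t)) =
  swap_box k.+1 (swap_box k (swap_box k.+1 t)).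
Proof.
elim: t => // i r IHr; rewrite [size _]/= ltnS leq_eqVlt.
case/predU1P=> [szr | ltkr]; last first.
  by rewrite !swap_box_cons ?size_swap_box ?IHr //; lia.
case: r szr {IHr} => [|j [|l r]] // [->].
have neqS : ((size r).+2 == (size r).+1) = false by rewrite gtn_eqF.
by do !rewrite /= ?neqS ?eqxx.
Qed.

Lemma std_word_mono t i j : std_word t -> (i <= j)%N ->
  (count_mem j t <= count_mem i t)%N.
Proof.
move=> std_t; elim: j => [|j IHj]; first by rewrite leqn0 => /eqP->.
rewrite leq_eqVlt => /predU1P[-> // | /IHj]; apply: leq_trans.
elim: t std_t {IHj} => //= a t IHt /andP[/IHt le_t].
by case: a => [|a] /=; rewrite ?eqSS; [lia | case: (a =P j) => [->|_]; lia].
Qed.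

(** * The semi-normal action on functions of tableaux *)

Section SemiNormal.
Variables (K : fieldType) (q : K).
Hypotheses (q_neq0 : q != 0) (q_generic : forall m, (1 < m)%N -> q ^+ m != 1).

Lemma q_exp_neq1 m : (0 < m)%N -> q ^+ m != 1.
Proof.
case: m => [|[|m]] // _; last exact: q_generic.
apply: contra (q_generic (isT : 1 < 2)%N).
by rewrite expr1 => /eqP->; rewrite expr1n.
Qed.

Lemma q_exp_inj : injective (GRing.exp q).
Proof.
suff wlog_le a b : (a <= b)%N -> q ^+ a = q ^+ b -> a = b.
  move=> a b eq_ab; case: (leqP a b) => [/wlog_le|/ltnW/wlog_le/(_ (esym eq_ab))]; auto.
move=> leab; rewrite -{1}(subnKC leab) exprD -[LHS]mulr1.
move/(mulfI (expf_neq0 a q_neq0))/esym/eqP; case: (posnP (b - a)); first lia.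
by move/q_exp_neq1/negPf->.
Qed.

(** [q] to the content of the box added to [t] in row [i]. *)
Definition content (i : nat) (t : seq nat) : K := q ^+ count_mem i t / q ^+ i.

Fixpoint box (k : nat) (t : seq nat) : K :=
  if t is i :: r then (if size r == k then content i r else box k r) else 0.

Lemma content_eq i s j t :
  (content i s == content j t) = (count_mem i s + j == count_mem j t + i)%N.
Proof.
by rewrite /content eqr_div ?expf_neq0 // -!exprD (inj_eq q_exp_inj).
Qed.

Lemma content_mulq i s j t : (q * content i s == content j t) =
  (count_mem i s + j.+1 == count_mem j t + i)%N.
Proof.
rewrite /content mulrA -exprS eqr_div ?expf_neq0 // -!exprD (inj_eq q_exp_inj).
by rewrite addSnnS.
Qed.

Lemma box_cons k i r : (k < size r)%N -> box k (i :: r) = box k r.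
Proof. by move=> ltkr; rewrite /= gtn_eqF. Qed.

Lemma box_head i r : box (size r) (i :: r) = content i r.
Proof. by rewrite /= eqxx. Qed.

Lemma box_neqS k t : std_word t -> (k.+1 < size t)%N -> box k t != box k.+1 t.
Proof.
elim: t => // i r IHr std_t; rewrite [size _]/= ltnS leq_eqVlt.
case/predU1P=> [szr | ltkr]; last first.
  by rewrite !box_cons ?IHr //; [case/andP: std_t | lia].
rewrite szr box_head box_cons -?szr //.
case: r szr std_t {IHr} => // j r [->] /= /andP[/andP[std_r _] _].
rewrite eqxx content_eq /=.
case: (ltngtP i j) => [lt_ij | lt_ji | ->]; rewrite /= ?eqxx; last by lia.
  by have /= := std_word_mono std_r (ltnW lt_ij); lia.
by have /= := std_word_mono std_r (ltnW lt_ji); lia.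
Qed.

(** The next box on a diagonal needs its left and its upper neighbour first, and both come after the
    previous box of that diagonal. Equal contents are therefore at least three steps apart, which
    keeps every denominator of the braid relation nonzero. *)
Lemma box_neqSS k t : std_word t -> (k.+2 < size t)%N -> box k t != box k.+2 t.
Proof.
elim: t => // i r IHr std_t; rewrite [size _]/= ltnS leq_eqVlt.
case/predU1P=> [szr | ltkr]; last first.
  by rewrite !box_cons ?IHr //; [case/andP: std_t | lia].
rewrite szr box_head box_cons -?szr //.
case: r szr std_t {IHr} => [|j [|l r]] // [->] std_t.
rewrite box_cons // box_head content_eq /=.
case/andP: std_t => /= /andP[/andP[std_r _] le_j] le_i.
case: (ltngtP i l) => [lt_il | lt_li | ->]; rewrite /= ?eqxx; last by lia.
  by have /= := std_word_mono std_r (ltnW lt_il); lia.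
case: i lt_li le_i => // i lt_li /= le_i.
have := std_word_mono std_r (lt_li : l <= i)%N.
have := std_word_mono std_r (leqnSn i).
rewrite /=; case: (j =P i.+1) le_i => [->|neq_ji] le_i; last by lia.
rewrite (gtn_eqF (ltnSn i)) /= in le_i.
by case: (l =P i) le_i lt_li => [->|neq_li]; lia.
Qed.

Lemma box_swap_other k m t : m != k -> m != k.+1 ->
  box m (swap_box k t) = box m t.
Proof.
move=> neq_mk neq_mk1; elim: t => //= i r IHr.
case: (size r =P k.+1) => [szr | _]; last first.
  by rewrite /= size_swap_box IHr /content count_swap_box.
case: r szr {IHr} => //= j r [szr].
by rewrite szr !(eq_sym k) (eq_sym k.+1) (negPf neq_mk) (negPf neq_mk1).
Qed.

(** Matrix entries of [T_k] in terms of the boxes [x], [y] holding [k], [k + 1]: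
    the diagonal one, and the one leading to the tableau with these exchanged. *)
Definition diag_coef (x y : K) : K := (q - 1) * y / (y - x).
Definition swap_coef (x y : K) : K := (q * x != y)%:R * ((q * y - x) / (y - x)).

(** The Boolean guard disappears in the symmetric product, where [q * x - y] vanishes by itself. *)
Lemma swap_coef_mul x y : x != y ->
  swap_coef x y * swap_coef y x = - ((q * y - x) * (q * x - y)) / (y - x) ^+ 2.
Proof.
move=> neq_xy; have ? : x - y != 0 by rewrite subr_eq0.
have ? : y - x != 0 by rewrite subr_eq0 eq_sym.
rewrite /swap_coef; case: (eqVneq (q * x) y) => [-> | _].
  by rewrite !mul0r subrr mulr0 oppr0 mul0r.
case: (eqVneq (q * y) x) => [-> | _]; first by rewrite !mul0r mulr0 subrr mul0r oppr0 mul0r.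
by rewrite !mul1r; field; apply/andP.
Qed.

(** A swap can fail to be standard only for adjacent boxes: in one column [q * y = x] kills the
    numerator of [swap_coef], in one row [q * x = y] is excluded by its guard. *)
Lemma swap_box_std k t : std_word t -> (k.+1 < size t)%N ->
    swap_coef (box k t) (box k.+1 t) != 0 ->
  [/\ std_word (swap_box k t), box k (swap_box k t) = box k.+1 t
    & box k.+1 (swap_box k t) = box k t].
Proof.
elim: t => // i r IHr std_t; rewrite [size _]/= ltnS leq_eqVlt.
case/predU1P=> [szr | ltkr]; last first.
  rewrite swap_box_cons // !box_cons ?size_swap_box //; try lia.
  case/andP: std_t => std_r le_i bN0; have [std_s -> ->] := IHr std_r ltkr bN0.
  by split=> //=; rewrite std_s !count_swap_box.
case: r szr std_t {IHr} => // j r [szr] std_t.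
rewrite swap_box_head // szr (box_head i (j :: r)) box_cons // box_head.
rewrite (box_head j (i :: r)) box_cons // box_head.
rewrite /swap_coef; case: (eqVneq (q * content j r)) => [_ | ]; first by rewrite mul0r eqxx.
rewrite content_mulq => /eqP neq_ij;
  rewrite mul1r mulf_eq0 subr_eq0 content_mulq => /norP[nvert _].
have neqij : i != j by apply/eqP=> eq_ij; apply: neq_ij; rewrite eq_ij /= eqxx; lia.
have neqji := negPf neqij; rewrite eq_sym in neqji.
split; [| by rewrite /content /= ?neqji ?(negPf neqij) add0n..].
move: std_t nvert => /= /andP[/andP[-> le_j] le_i].
rewrite neqji (negPf neqij) /= add0n => nvert; apply/andP; split; last by lia.
clear -le_i neqji nvert; case: i le_i neqji nvert => //= i.
by case: (j =P i) => [->|_]; rewrite ?eqxx /=; lia.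
Qed.

(** Row [t] of the matrix of [T_k] applied to [f]. It is defined on all words, with no shape or size
    fixed; a swap leaving the standard tableaux carries coefficient 0. *)
Definition theta (k : nat) (f : seq nat -> K) (t : seq nat) : K :=
  diag_coef (box k t) (box k.+1 t) * f t
  + swap_coef (box k t) (box k.+1 t) * f (swap_box k t).

Lemma diag_coef_sum x y : x != y -> diag_coef x y + diag_coef y x = q - 1.
Proof.
move=> neq_xy; have ? : x - y != 0 by rewrite subr_eq0.
have ? : y - x != 0 by rewrite subr_eq0 eq_sym.
by rewrite /diag_coef; field; apply/andP.
Qed.

Lemma diag_coef_quad x y : x != y ->
  diag_coef x y ^+ 2 + swap_coef x y * swap_coef y x = (q - 1) * diag_coef x y + q.
Proof.
move=> neq_xy; have ? : y - x != 0 by rewrite subr_eq0 eq_sym.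
by rewrite swap_coef_mul // /diag_coef; field.
Qed.

(** Cayley-Hamilton for the block of [t] and its swap: trace [q - 1] by [diag_coef_sum], determinant
    [- q] by [diag_coef_quad]. *)
Lemma theta_quad k f t : std_word t -> (k.+1 < size t)%N ->
  theta k (theta k f) t = (q - 1) * theta k f t + q * f t.
Proof.
move=> std_t lt_k; have neq_box := box_neqS std_t lt_k.
have quad := diag_coef_quad neq_box; have sumA := diag_coef_sum neq_box.
rewrite {1}/theta; set x := box k t; set y := box k.+1 t.
have -> : swap_coef x y * theta k f (swap_box k t) =
    swap_coef x y * (diag_coef y x * f (swap_box k t) + swap_coef y x * f t).
  case: (eqVneq (swap_coef x y) 0) => [-> | bN0]; first by rewrite !mul0r.
  by have [_ e1 e2] := swap_box_std std_t lt_k bN0; rewrite /theta e1 e2 swap_boxK.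
rewrite /theta -/x -/y in quad sumA *.
have -> : diag_coef y x = q - 1 - diag_coef x y by rewrite -sumA addrAC subrr add0r.
have -> : q * f t = (diag_coef x y ^+ 2 +
  swap_coef x y * swap_coef y x - (q - 1) * diag_coef x y) * f t.
  by rewrite quad addrAC subrr add0r.
by ring.
Qed.

Lemma theta_comm k l f t : (k.+1 < l)%N -> (l.+1 < size t)%N ->
  theta k (theta l f) t = theta l (theta k f) t.
Proof.
move=> lt_kl lt_l; rewrite /theta (@swap_box_comm k l) //.
rewrite !(@box_swap_other k l) ?(@box_swap_other k l.+1) //; try lia.
rewrite !(@box_swap_other l k) ?(@box_swap_other l k.+1) //; try lia.
by ring.
Qed.

(** The coefficient of [f t] on the two sides of the braid relation; the next lemma serves the two
    single swaps. The coefficients at longer swaps agree up to the order of their factors. *)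
Lemma diag_coef_braid_diag x y z : x != y -> y != z -> x != z ->
  diag_coef x y * diag_coef y z * diag_coef x y +
    swap_coef x y * diag_coef x z * swap_coef y x =
  diag_coef y z * diag_coef x y * diag_coef y z +
    swap_coef y z * diag_coef x z * swap_coef z y.
Proof.
move=> neq_xy neq_yz neq_xz.
have ? : y - x != 0 by rewrite subr_eq0 eq_sym.
have ? : z - y != 0 by rewrite subr_eq0 eq_sym.
have ? : z - x != 0 by rewrite subr_eq0 eq_sym.
rewrite [_ * swap_coef y x]mulrAC [_ * swap_coef z y]mulrAC !swap_coef_mul // /diag_coef.
by field; do ?[apply/andP; split].
Qed.

Lemma diag_coef_braid x y z : x != y -> y != z -> x != z ->
  diag_coef x y * diag_coef y z + diag_coef x z * diag_coef y x =
    diag_coef y z * diag_coef x z /\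
  diag_coef y z * diag_coef x y + diag_coef x z * diag_coef z y =
    diag_coef x y * diag_coef x z.
Proof.
move=> neq_xy neq_yz neq_xz; have ? : x - y != 0 by rewrite subr_eq0.
have ? : y - x != 0 by rewrite subr_eq0 eq_sym.
have ? : z - y != 0 by rewrite subr_eq0 eq_sym.
have ? : y - z != 0 by rewrite subr_eq0.
have ? : z - x != 0 by rewrite subr_eq0 eq_sym.
by split; rewrite /diag_coef; field; do ?[apply/andP; split].
Qed.

Lemma theta_braid k f t : std_word t -> (k.+2 < size t)%N ->
  theta k (theta k.+1 (theta k f)) t = theta k.+1 (theta k (theta k.+1 f)) t.
Proof.
move=> std_t lt_k.
(* Each term of the expansion either has coefficient 0 or sits at a standard word whose three boxes
   are known; carrying this disjunction avoids splitting on which swaps are standard. *)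
pose P u x y z := [/\ std_word u, size u = size t, box k u = x, box k.+1 u =
  y & box k.+2 u = z].
have swap1 u x y z : P u x y z -> swap_coef x y = 0 \/ P (swap_box k u) y x z.
  case=> std_u sz_u <- <- <-; have [|bN0] := eqVneq (swap_coef (box k u) (box k.+1 u)) 0;
    [by left | right].
  have lt_ku : (k.+1 < size u)%N by lia.
  have [std_s e1 e2] := swap_box_std std_u lt_ku bN0.
  by split=> //; rewrite ?size_swap_box ?box_swap_other //; lia.
have swap2 u x y z : P u x y z -> swap_coef y z = 0 \/ P (swap_box k.+1 u) x z y.
  case=> std_u sz_u <- <- <-; have [|bN0] :=
    eqVneq (swap_coef (box k.+1 u) (box k.+2 u)) 0; [by left | right].
  have lt_ku : (k.+2 < size u)%N by lia.
  have [std_s e1 e2] := swap_box_std std_u lt_ku bN0.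
  by split=> //; rewrite ?size_swap_box ?box_swap_other //; lia.
have theta1 u x y z c g : c = 0 \/ P u x y z ->
    c * theta k g u = diag_coef x y * (c * g u) + (c * swap_coef x y) * g (swap_box k u).
  by case=> [-> | [_ _ <- <- _]]; rewrite /theta; ring.
have theta2 u x y z c g : c = 0 \/ P u x y z ->
    c * theta k.+1 g u = diag_coef y z * (c * g u) +
      (c * swap_coef y z) * g (swap_box k.+1 u).
  by case=> [-> | [_ _ _ <- <-]]; rewrite /theta; ring.
have mul0_or (c d : K) (Q R : Prop) : c = 0 \/ Q -> (Q -> d = 0 \/ R) -> c * d = 0 \/ R.
  case=> [-> _|HQ /(_ HQ)[->|]]; [by left; rewrite mul0r | | by right].
  by left; rewrite mulr0.
set x := box k t; set y := box k.+1 t; set z := box k.+2 t.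
have Pt : P t x y z by [].
have P1 := swap1 _ _ _ _ Pt; have P2 := swap2 _ _ _ _ Pt.
have P21 := mul0_or _ _ _ _ P1 (@swap2 _ _ _ _).
have P12 := mul0_or _ _ _ _ P2 (@swap1 _ _ _ _).
have nxy : x != y by apply: box_neqS => //; lia.
have nyz : y != z by apply: box_neqS.
have nxz : x != z by apply: box_neqSS.
have E1 g : theta k g t = diag_coef x y * g t + swap_coef x y * g (swap_box k t) by [].
have E2 g : theta k.+1 g t = diag_coef y z * g t +
  swap_coef y z * g (swap_box k.+1 t) by [].
rewrite !(E1, E2, theta1 _ _ _ _ _ _ P1, theta2 _ _ _ _ _ _ P1,
  theta1 _ _ _ _ _ _ P2, theta2 _ _ _ _ _ _ P2,
  theta1 _ _ _ _ _ _ P21, theta2 _ _ _ _ _ _ P12, swap_boxK).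
rewrite swap_box_braid //.
have /eqP := diag_coef_braid_diag nxy nyz nxz; rewrite -subr_eq0 => /eqP diag0.
have [/eqP + /eqP] := diag_coef_braid nxy nyz nxz.
rewrite -subr_eq0 => /eqP off1; rewrite -subr_eq0 => /eqP off2.
(* The three vanishing combinations are inserted with the multipliers under which the difference of
   the two sides becomes a ring identity. *)
apply/eqP; rewrite -subr_eq0 -(mul0r (f t)) -diag0; apply/eqP.
rewrite -[RHS]addr0 -[in RHS](mul0r (swap_coef x y * f (swap_box k t))) -off1.
rewrite -[RHS]subr0 -[in RHS](mul0r (swap_coef y z * f (swap_box k.+1 t))) -off2.
by ring.
Qed.
End SemiNormal.

(** * Enumeration of the standard tableaux *)

Definition addable (t : seq nat) : seq nat :=
  [seq i <- iota 0 (size t).+1 | (i == 0) || (count_mem i t < count_mem i.-1 t)]%N.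

Fixpoint std_words (n : nat) : seq (seq nat) :=
  if n is m.+1 then [seq i :: t | t <- std_words m, i <- addable t]
  else [:: [::]].

Lemma std_word_lt t i : std_word t -> i \in t -> (i < size t)%N.
Proof.
elim: t i => // a t IHt i /andP[std_t add_a].
have lt_a : (a <= size t)%N.
  case: a add_a => //= a lt_a; apply: IHt => //.
  by rewrite -has_pred1 has_count (leq_ltn_trans _ lt_a).
by rewrite inE => /predU1P[->|/(IHt _ std_t)] /=; lia.
Qed.

Lemma mem_addable i t : std_word (i :: t) = std_word t && (i \in addable t).
Proof.
rewrite mem_filter mem_iota add0n /=; case std_t: (std_word t) => //=.
case: orP => //= add_i; rewrite ltnS.
case: add_i => [/eqP-> // | lt_i]; case: i lt_i => //= i lt_i.
apply/esym/(std_word_lt std_t).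
by rewrite -has_pred1 has_count (leq_ltn_trans _ lt_i).
Qed.

Lemma mem_std_words n t : (t \in std_words n) = std_word t && (size t == n).
Proof.
elim: n t => [|n IHn] [|i t] //; first by rewrite inE andbF.
  by apply/negbTE/negP=> /allpairsPdep[? [? [_ _]]].
rewrite mem_addable [size _]/= eqSS andbAC -IHn.
apply/allpairsPdep/andP => [[t' [i' [St' add_i [-> ->]]]] // | [St add_i]].
by exists t, i.
Qed.

Lemma std_words_uniq n : uniq (std_words n).
Proof.
elim: n => // n IHn; apply: allpairs_uniq_dep => // [t _|].
  by rewrite filter_uniq ?iota_uniq.
by move=> [t i] [t' i'] _ _ /= [-> ->].
Qed.

(** * Stable sets of tableaux and their matrices *)

Section StableSets.
Variables (K : fieldType) (q : K).
Hypotheses (q_neq0 : q != 0) (q_generic : forall m, (1 < m)%N -> q ^+ m != 1).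

(** The nodes addable to a given shape lie on distinct diagonals, so a tableau is rebuilt box by box
    from its contents. *)
Lemma box_sep n s t : s \in std_words n -> t \in std_words n ->
  (forall k, (k < n)%N -> box q k s = box q k t) -> s = t.
Proof.
elim: n s t => [|n IHn] [|i s] [|j t]; rewrite ?mem_std_words ?andbF //.
move=> /andP[std_is /eqP[sz_s]] /andP[std_jt /eqP[sz_t]] eq_box.
have /andP[std_s _] : std_word s && _ := std_is.
have /andP[std_t _] : std_word t && _ := std_jt.
have eq_st : s = t.
  apply: IHn; rewrite ?mem_std_words ?std_s ?std_t ?sz_s ?sz_t ?eqxx // => k ltkn.
  by rewrite -(@box_cons _ q k i) ?sz_s // eq_box ?box_cons ?sz_t //; lia.
rewrite -eq_st in sz_t eq_box *; congr (_ :: _).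
have := eq_box n (ltnSn n); rewrite -{1 2}sz_s !box_head => /eqP.
rewrite content_eq //; case: (ltngtP i j) => // lt_ij.
  by have /= := std_word_mono std_s (ltnW lt_ij); lia.
by have /= := std_word_mono std_s (ltnW lt_ij); lia.
Qed.

(** This is [T_k L_k T_k = q L_(k+1)], where [L_k] acts diagonally by [box q k]. *)
Lemma theta_jucys_murphy k f t : std_word t -> (k.+1 < size t)%N ->
  theta q k (fun s => box q k s * theta q k f s) t = q * (box q k.+1 t * f t).
Proof.
move=> std_t lt_k; have neq_box := box_neqS q_neq0 q_generic std_t lt_k.
rewrite {1}/theta; set x := box q k t; set y := box q k.+1 t.
have -> : swap_coef q x y * (box q k (swap_box k t) * theta q k f (swap_box k t)) =
    swap_coef q x y * (y * (diag_coef q y x * f (swap_box k t) + swap_coef q y x * f t)).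
  case: (eqVneq (swap_coef q x y) 0) => [-> | bN0]; first by rewrite !mul0r.
  have [_ e1 e2] := swap_box_std q_neq0 q_generic std_t lt_k bN0.
  by rewrite /theta e1 e2 swap_boxK.
rewrite /theta -/x -/y in neq_box *.
have ? : x - y != 0 by rewrite subr_eq0.
have ? : y - x != 0 by rewrite subr_eq0 eq_sym.
have -> : diag_coef q x y * (x * (diag_coef q x y * f t +
  swap_coef q x y * f (swap_box k t))) +
  swap_coef q x y * (y * (diag_coef q y x * f (swap_box k t) + swap_coef q y x * f t)) =
  (diag_coef q x y ^+ 2 * x + swap_coef q x y * swap_coef q y x * y) * f t +
  swap_coef q x y * (diag_coef q x y * x + diag_coef q y x * y) * f (swap_box k t) by ring.
rewrite swap_coef_mul // (_ : diag_coef q x y * x + diag_coef q y x * y = 0).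
  by rewrite /diag_coef; field.
by rewrite /diag_coef; field; apply/andP.
Qed.

(** The sets that carry a representation; the tableaux of one shape form such a set, and so do all
    tableaux of size [n]. *)
Definition stable (n : nat) (S : seq (seq nat)) : Prop :=
  [/\ uniq S, {subset S <= std_words n}
    & forall k t, t \in S -> (k.+1 < n)%N ->
        swap_coef q (box q k t) (box q k.+1 t) != 0 -> swap_box k t \in S].

Lemma std_words_stable n : stable n (std_words n).
Proof.
split; [exact: std_words_uniq | by [] | move=> k t].
rewrite !mem_std_words => /andP[std_t /eqP <-] lt_k bN0.
by have [-> _ _] := swap_box_std q_neq0 q_generic std_t lt_k bN0;
  rewrite size_swap_box eqxx.
Qed.

Definition delta (t : seq nat) (s : seq nat) : K := (s == t)%:R.

Definition thetas (u : seq nat) (f : seq nat -> K) : seq nat -> K :=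
  foldr (theta q) f u.

Lemma delta_sum (S : seq (seq nat)) t (f : seq nat -> K) : uniq S -> t \in S ->
  f t = \sum_(r <- S) delta r t * f r.
Proof.
move=> uniqS St; rewrite (bigD1_seq t) //= /delta eqxx mul1r big1 ?addr0 // => r.
by rewrite eq_sym => /negPf->; rewrite mul0r.
Qed.

Lemma theta_sum n S k f t : stable n S -> (k.+1 < n)%N -> t \in S ->
  theta q k f t = \sum_(r <- S) theta q k (delta r) t * f r.
Proof.
case=> uniqS _ closedS ltkn St; rewrite {1}/theta (delta_sum f uniqS St).
rewrite mulr_sumr.
have -> : swap_coef q (box q k t) (box q k.+1 t) * f (swap_box k t) =
    \sum_(r <- S) swap_coef q (box q k t) (box q k.+1 t) * (delta r (swap_box k t) * f r).
  rewrite -mulr_sumr; have [->|bN0] := eqVneq (swap_coef q (box q k t) (box q k.+1 t)) 0.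
    by rewrite !mul0r.
  by rewrite (delta_sum f uniqS) ?closedS.
by rewrite -big_split /=; apply: eq_bigr => r _; rewrite /theta; ring.
Qed.

Lemma thetas_sum n S u f t : stable n S -> all (fun k => (k.+1 < n)%N) u -> t \in S ->
  thetas u f t = \sum_(r <- S) thetas u (delta r) t * f r.
Proof.
move=> stS; elim: u t => [|k u IHu] t /=.
  by move=> _ St; case: stS => uniqS _ _; apply: delta_sum.
case/andP=> ltkn all_u St; rewrite (theta_sum _ stS) //.
under [RHS]eq_bigr => r _ do rewrite (theta_sum _ stS) // mulr_suml.
rewrite exchange_big /= !big_seq; apply: eq_bigr => s Ss.
by rewrite IHu // mulr_sumr; apply: eq_bigr => r _; rewrite mulrA.
Qed.

Section Matrices.
Variables (n d : nat) (S : seq (seq nat)).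
Hypotheses (stS : stable n S) (szS : size S = d.+1).

Definition mx_of (F : seq nat -> seq nat -> K) : 'M[K]_d.+1 :=
  \matrix_(i < d.+1, j < d.+1) F (nth [::] S i) (nth [::] S j).

Definition theta_mx (k : nat) : 'M[K]_d.+1 := mx_of (fun s t => theta q k (delta t) s).

Lemma sum_nth (V : nmodType) (F : seq nat -> V) :
  \sum_(i < d.+1) F (nth [::] S i) = \sum_(t <- S) F t.
Proof. by rewrite (big_nth [::]) szS big_mkord. Qed.

Lemma mem_nthS (i : 'I_d.+1) : nth [::] S i \in S.
Proof. by rewrite mem_nth // szS. Qed.

Lemma delta_nth (i j : 'I_d.+1) : delta (nth [::] S j) (nth [::] S i) = (i == j)%:R.
Proof.
by case: stS => uniqS _ _; rewrite /delta nth_uniq ?szS.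
Qed.

Lemma mx_of_eq F G : (forall s t, s \in S -> t \in S -> F s t = G s t) -> mx_of F = mx_of G.
Proof. by move=> eqFG; apply/matrixP=> i j; rewrite !mxE eqFG ?mem_nthS. Qed.

Lemma mx_of1 : mx_of (fun s t => delta t s) = 1.
Proof. by apply/matrixP=> i j; rewrite !mxE delta_nth. Qed.

Lemma theta_mxM k F : (k.+1 < n)%N ->
  theta_mx k * mx_of F = mx_of (fun s t => theta q k (F^~ t) s).
Proof.
move=> ltkn; apply/matrixP=> i j; rewrite !mxE (theta_sum _ stS) ?mem_nthS //.
by rewrite -sum_nth; apply: eq_bigr => l _; rewrite !mxE.
Qed.

Lemma diag_mxM f F :
  mx_of (fun s t => f s * delta t s) * mx_of F = mx_of (fun s t => f s * F s t).
Proof.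
apply/matrixP=> i j; rewrite !mxE (bigD1 i) //= big1 => [|l neq_li].
  by rewrite !mxE delta_nth eqxx mulr1 addr0.
by rewrite !mxE delta_nth eq_sym (negPf neq_li) mulr0 mul0r.
Qed.

Lemma thetas_mx u : all (fun k => (k.+1 < n)%N) u ->
  \prod_(k <- u) theta_mx k = mx_of (fun s t => thetas u (delta t) s).
Proof.
elim: u => [_|k u IHu /= /andP[ltkn /IHu IH]]; first by rewrite big_nil mx_of1.
by rewrite big_cons IH theta_mxM.
Qed.

Lemma trace_mx_of F : \tr (mx_of F) = \sum_(t <- S) F t t.
Proof. by rewrite /mxtrace -sum_nth; apply: eq_bigr => i _; rewrite !mxE. Qed.

Lemma stable_std s : s \in S -> std_word s /\ size s = n.
Proof. by case: stS => _ subS _ /subS; rewrite mem_std_words => /andP[-> /eqP]. Qed.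

Lemma theta_mx_braided : braided *%R theta_mx n.-1.
Proof.
split=> [k lt_k | k l lt_kl lt_l] /=.
  have [lt1 lt2] : (k.+1 < n)%N /\ (k.+2 < n)%N by lia.
  rewrite -!mulrA !theta_mxM //; apply: mx_of_eq => s t /stable_std[std_s sz_s] _.
  by rewrite theta_braid ?sz_s.
have [lt1 lt2] : (k.+1 < n)%N /\ (l.+1 < n)%N by lia.
rewrite !theta_mxM //; apply: mx_of_eq => s t /stable_std[std_s sz_s] _.
by rewrite theta_comm ?sz_s.
Qed.

Lemma theta_mx_quad k : (k < n.-1)%N ->
  theta_mx k * theta_mx k = (q - 1) *: theta_mx k + q%:A.
Proof.
move=> lt_k; have lt1 : (k.+1 < n)%N by lia.
rewrite theta_mxM // -mx_of1; apply/matrixP=> i j.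
have [std_i sz_i] := stable_std (mem_nthS i).
by rewrite !mxE theta_quad ?sz_i.
Qed.

End Matrices.
End StableSets.

(** * The semi-normal representations *)

Section Representations.
Variables (K : fieldType) (q : K).
Hypotheses (q_neq0 : q != 0) (q_generic : forall m, (1 < m)%N -> q ^+ m != 1).
Variables (N : nat) (H : heckeAlgebra q N.+1).

Definition affords (d : nat) (S : seq (seq nat)) (rho : {lrmorphism H ->
  'M[K]_d.+1}) : Prop :=
  [/\ stable q N.+1 S, size S = d.+1
    & forall k, (k < N)%N -> rho (hgen H k) = theta_mx q d S k].

Lemma affords_ex d S : stable q N.+1 S -> size S = d.+1 ->
  exists rho : {lrmorphism H -> 'M[K]_d.+1}, affords S rho.
Proof.
move=> stS szS.
have [rho rhoE] := hecke_lrmorphism H (theta_mx_braided q_neq0 q_generic stS szS)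
  (theta_mx_quad q_neq0 q_generic stS szS).
by exists rho.
Qed.

Lemma affords_word d S (rho : {lrmorphism H -> 'M[K]_d.+1}) u :
    affords S rho -> all (fun k => (k < N)%N) u ->
  rho (\prod_(k <- u) hgen H k) = mx_of d S (fun s t => thetas q u (delta K t) s).
Proof.
case=> stS szS rhoE all_u; rewrite rmorph_prod -(thetas_mx stS szS) //.
by apply: eq_big_seq => k uk; apply/rhoE/(allP all_u).
Qed.

(** The multiplicative Jucys-Murphy elements; the first is 1 because the first box has content 0. *)
Fixpoint jucys_murphy (k : nat) : H :=
  if k is k'.+1 then q^-1 *: (hgen H k' * jucys_murphy k' * hgen H k') else 1.

(** A single [h] must serve all stable sets: later it is compared across different shapes. *)
Definition diagonal (f : seq nat -> K) : Prop :=
  exists h : H, forall d S (rho : {lrmorphism H -> 'M[K]_d.+1}), affords S rho ->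
    rho h = mx_of d S (fun s t => f s * delta K t s).

Lemma box0 t : std_word t -> (0 < size t)%N -> box q 0 t = 1.
Proof.
elim: t => // i [|j t] IHt std_t _.
  by case: i std_t => //= _; rewrite /content !expr0 divr1.
rewrite box_cons // IHt //; by have /andP[] : std_word (j :: t) && _ := std_t.
Qed.

Lemma diagonal_box k : (k <= N)%N -> diagonal (box q k).
Proof.
move=> lekN; exists (jucys_murphy k) => d S rho [stS szS rhoE].
elim: k lekN => [_|k IHk ltkN] /=.
  rewrite rmorph1 -(mx_of1 stS szS); apply: (mx_of_eq szS) => s t Ss _.
  by have [std_s sz_s] := stable_std stS Ss; rewrite box0 ?mul1r ?sz_s.
rewrite linearZ !rmorphM /= rhoE // IHk; last by lia.
rewrite -mulrA (diag_mxM stS szS) (theta_mxM stS szS) //.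
apply/matrixP=> i j; rewrite !mxE.
have [std_i sz_i] := stable_std stS (mem_nthS szS i).
by rewrite (theta_jucys_murphy q_neq0 q_generic) ?sz_i // mulrA mulVf ?mul1r.
Qed.

Lemma diagonal_mul f g : diagonal f -> diagonal g -> diagonal (fun s => f s * g s).
Proof.
move=> [a aE] [b bE]; exists (a * b) => d S rho aff; have [stS szS _] := aff.
rewrite rmorphM /= (aE _ _ _ aff) (bE _ _ _ aff) (diag_mxM stS szS).
by apply: (mx_of_eq szS) => s t _ _; rewrite mulrA.
Qed.

Lemma diagonal_affine f a b : diagonal f -> diagonal (fun s => a * f s + b).
Proof.
move=> [h hE]; exists (a *: h + b%:A) => d S rho aff; have [stS szS _] := aff.
rewrite linearD !linearZ rmorph1 /= (hE _ _ _ aff) -(mx_of1 stS szS).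
by apply/matrixP=> i j; rewrite !mxE mulrDl mulrA.
Qed.

(** Interpolation in the Jucys-Murphy elements, with one factor for each other tableau, taken at a
    box where its content differs from that of [t]. *)
Lemma diagonal_delta t : t \in std_words N.+1 -> diagonal (delta K t).
Proof.
move=> St.
have sep (L : seq (seq nat)) : {subset L <= std_words N.+1} ->
    exists f, [/\ diagonal f, f t = 1 & forall s, s \in L -> s != t -> f s = 0].
  elim: L => [_|r L IHL subL].
    exists (fun=> 1); split=> //; exists 1 => d S rho [stS szS _].
    rewrite rmorph1 -(mx_of1 stS szS); apply: (mx_of_eq szS) => *; exact/esym/mul1r.
  have [|f [df ft f0]] := IHL; first by move=> s Ls; apply: subL; rewrite inE Ls orbT.
  have [eq_rt | neq_rt] := eqVneq r t.
    by exists f; split=> // s; rewrite inE => /predU1P[-> /eqP //|]; apply: f0.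
  have [k lekN neq_k] : exists2 k, (k < N.+1)%N & box q k r != box q k t.
    have Sr : r \in std_words N.+1 by apply/subL/mem_head.
    have /existsP[k neq_k] : [exists k : 'I_N.+1, box q k r != box q k t].
      apply: contraNT neq_rt => /existsPn eq_rt; apply/eqP.
      apply: (box_sep q_neq0 q_generic Sr St) => k ltkN.
      by have /negPn/eqP := eq_rt (Ordinal ltkN).
    by exists k.
  (* The new factor is the affine function of [box q k] with value 1 at [t] and 0 at [r]. *)
  pose c := (box q k t - box q k r)^-1.
  have c_neq0 : box q k t - box q k r != 0 by rewrite subr_eq0 eq_sym.
  exists (fun s => f s * (c * box q k s + - c * box q k r)); split.
  - by apply/diagonal_mul/diagonal_affine/diagonal_box.
  - by rewrite ft mul1r mulNr -mulrBr mulVf.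
  move=> s; rewrite inE => /predU1P[-> _|Ls neq_st].
    by rewrite mulNr subrr mulr0.
  by rewrite f0 ?mul0r.
have [f [[h hE] ft f0]] := sep _ (fun s => id).
exists h => d S rho aff; have [stS szS _] := aff; rewrite (hE _ _ _ aff).
apply: (mx_of_eq szS) => s r Ss _; congr (_ * _).
case: stS => _ subS _; rewrite [RHS]/delta.
by case: eqVneq => [-> // | neq_st]; rewrite f0 ?subS.
Qed.

(** Connectedness as an induction principle, applied below to the tableaux whose coordinate vector
    lies in a submodule. *)
Definition swap_connected (S : seq (seq nat)) : Prop :=
  forall P : seq nat -> Prop,
  (forall k s, s \in S -> (k < N)%N ->
     swap_coef q (box q k s) (box q k.+1 s) != 0 -> P s -> P (swap_box k s)) ->
  forall s t, s \in S -> t \in S -> P s -> P t.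

(** A diagonal matrix unit cuts a row with nonzero entry [j] down to a multiple of the [j]-th
    coordinate vector, and the generators spread this vector along the swaps with nonzero
    coefficient. *)
Lemma affords_irreducible d S (rho : {lrmorphism H -> 'M[K]_d.+1}) :
  affords S rho -> swap_connected S -> mx_rep_irreducible rho.
Proof.
move=> aff conS U stU nzU; have [stS szS rhoE] := aff.
have [_ subS closedS] := stS.
pose P s := forall l : 'I_d.+1, nth [::] S l = s -> ((delta_mx 0 l : 'rV[K]_d.+1) <= U)%MS.
have [i [j nzUij]] : exists i j, U i j != 0.
  by move: nzU => /matrix0Pn.
have PSj : P (nth [::] S j).
  move=> l /eqP; case: (stS) => uniqS _ _; rewrite nth_uniq ?szS // => /eqP/val_inj->.
  have [h hE] := diagonal_delta (subS _ (mem_nthS szS j)).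
  have := submx_trans (row_sub i _) (stU h); rewrite (hE _ _ _ aff).
  rewrite row_mul.
  have -> : row i U *m mx_of d S (fun s t => delta K (nth [::] S j) s * delta K t s) =
      U i j *: delta_mx 0 j.
    apply/rowP=> m; rewrite !mxE (bigD1 j) //= big1 => [|l' neq_l].
      by rewrite !mxE !(delta_nth stS szS) eqxx mul1r addr0 [m == j]eq_sym.
    by rewrite !mxE !(delta_nth stS szS) (negPf neq_l) mul0r mulr0.
  by rewrite (eqmx_scale _ nzUij).
have stepP k s : s \in S -> (k < N)%N ->
    swap_coef q (box q k s) (box q k.+1 s) != 0 -> P s -> P (swap_box k s).
  move=> Ss ltkN bN0 Ps m eq_m.
  have szs : (index s S < d.+1)%N by rewrite -szS index_mem.
  pose l := Ordinal szs; have eq_l : nth [::] S l = s by rewrite nth_index.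
  have := submx_trans (submxMr (rho (hgen H k)) (Ps l eq_l)) (stU _).
  rewrite rhoE // -rowE.
  have -> : row l (theta_mx q d S k) =
      diag_coef q (box q k s) (box q k.+1 s) *: delta_mx 0 l
      + swap_coef q (box q k s) (box q k.+1 s) *: delta_mx 0 m.
    apply/rowP=> j'; rewrite !mxE /theta eq_l -{3}eq_l -eq_m.
    by rewrite !(delta_nth stS szS) [_ == l]eq_sym [_ == m]eq_sym.
  move=> sub_lm; rewrite -(eqmx_scale _ bN0).
  rewrite -(addKr (diag_coef q (box q k s) (box q k.+1 s) *: delta_mx 0 l) (_ *: delta_mx
    0 m)).
  by rewrite addmx_sub ?eqmx_opp ?scalemx_sub ?Ps.
rewrite -sub1mx; apply/row_subP=> l; rewrite row1.
exact: (conS P stepP _ _ (mem_nthS szS j) (mem_nthS szS l) PSj).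
Qed.

End Representations.

(** * Connectedness of the tableaux of one shape *)

Lemma std_word_cons j r : std_word r ->
  (forall i, (count_mem i.+1 (j :: r) <= count_mem i (j :: r))%N) -> std_word (j :: r).
Proof.
move=> std_r mono; rewrite /= std_r /=; case: j mono => // j /(_ j) /=.
by rewrite eqxx gtn_eqF //= add0n add1n.
Qed.

(** The last box goes to the lowest occupied row: without it the row lengths still decrease
    weakly. *)
Lemma std_word_ex p : (forall i, (count_mem i.+1 p <= count_mem i p)%N) ->
  exists2 r, std_word r & perm_eq r p.
Proof.
move: {2}(size p) (eqxx (size p)) => n; elim: n p => [|n IHn] p szp mono.
  by exists [::] => //; rewrite (size0nil (eqP szp)).
have [m pm max_m] : exists2 m, m \in p & forall i, i \in p -> (i <= m)%N.
  exists (\max_(i <- p) i)%N; last by move=> i pi; apply: (@leq_bigmax_seq _ _ _ id).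
  case: p szp {mono} => // i p _; elim: p i => [|j p IHp] i;
    first by rewrite big_seq1 mem_head.
  rewrite big_cons; have := IHp j; case: (leqP i (\max_(i <- j :: p) i)%N) => _.
    by move=> max_in; rewrite inE max_in orbT.
  by rewrite mem_head.
have pE := perm_to_rem pm; have cntE := seq.permP pE.
have [|i|r std_r perm_r] := IHn (rem m p).
- by have := perm_size pE; rewrite (eqP szp) /= => -[<-].
- have := cntE (pred1 i); have := cntE (pred1 i.+1); have := mono i => /=.
  case: (m =P i) => [eq_mi | _]; last by case: (m =P i.+1) => *; lia.
  have : count_mem i.+1 p = 0%N.
    by apply/count_memPn/negP=> /max_m; rewrite eq_mi ltnn.
  by rewrite /=; case: (m =P i.+1) => *; lia.
have perm_mr : perm_eq (m :: r) p by rewrite perm_sym (perm_trans pE) // perm_cons perm_sym.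
exists (m :: r) => //; apply: std_word_cons => // i.
by rewrite !(seq.permP perm_mr).
Qed.

(** A converse to [swap_box_std]: two nodes in different rows, both addable to [r], have contents
    differing by at least 2. *)
Lemma std_word_swap_coef (K : fieldType) (q : K) i j r : q != 0 ->
    (forall m, (1 < m)%N -> q ^+ m != 1) -> i != j ->
    std_word (i :: j :: r) -> std_word (j :: i :: r) ->
  swap_coef q (box q (size r) (i :: j :: r)) (box q (size r).+1 (i :: j :: r)) != 0.
Proof.
move=> q_neq0 q_gen neq_ij std_ij std_ji.
have lt_count a b : std_word (b :: r) -> (a < b)%N -> (count_mem b r < count_mem a r)%N.
  move=> std_b lt_ab; have /= := std_word_mono std_b (ltnW lt_ab).
  by rewrite eqxx gtn_eqF.
have std_i : std_word (i :: r).
  by have /andP[] : std_word (i :: r) && _ := std_ji.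
have std_j : std_word (j :: r).
  by have /andP[] : std_word (j :: r) && _ := std_ij.
rewrite box_cons // box_head (box_head q i (j :: r)) /swap_coef.
have neq_ji : (j == i) = false by rewrite eq_sym (negPf neq_ij).
rewrite content_mulq //= neq_ji add0n mulf_neq0 //; last first.
  rewrite mulf_neq0 ?invr_eq0 ?subr_eq0 ?content_mulq ?content_eq //= neq_ji add0n.
    case: (ltngtP i j) neq_ij => // lt_ij _.
      by have /= := lt_count _ _ std_j lt_ij; lia.
    by have /= := lt_count _ _ std_i lt_ij; lia.
  case: (ltngtP i j) neq_ij => // lt_ij _.
    by have /= := lt_count _ _ std_j lt_ij; lia.
  by have /= := lt_count _ _ std_i lt_ij; lia.
suff -> : (count_mem j r + i.+1 != count_mem i r + j)%N by rewrite oner_eq0.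
case: (ltngtP i j) neq_ij => // lt_ij _.
  by have /= := lt_count _ _ std_j lt_ij; lia.
by have /= := lt_count _ _ std_i lt_ij; lia.
Qed.

(** Two different corners of one shape can be removed together. *)
Lemma rem_count_mono i j s t l : i != j -> std_word s -> std_word t ->
    perm_eq (i :: s) (j :: t) ->
  (count_mem l.+1 (rem j s) <= count_mem l (rem j s))%N.
Proof.
move=> neq_ij std_s std_t eq_st.
have js : j \in s.
  by have := perm_mem eq_st j; rewrite !inE eqxx eq_sym (negPf neq_ij).
have cntE a : count_mem a s = ((j == a) + count_mem a (rem j s))%N.
  by rewrite (seq.permP (perm_to_rem js)).
have cntE' a : ((i == a) + count_mem a s = (j == a) + count_mem a t)%N.
  exact: (seq.permP eq_st (pred1 a)).
have := std_word_mono std_s (leqnSn l); have := std_word_mono std_t (leqnSn l).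
move: (cntE l) (cntE l.+1) (cntE' l) (cntE' l.+1).
move: (count_mem l (rem j s)) (count_mem l.+1 (rem j s)) (count_mem l s) (count_mem l.+1 s).
move: (count_mem l t) (count_mem l.+1 t); clear -neq_ij.
case: (i =P l.+1) neq_ij => [-> | ?]; case: (j =P l) => [-> | ?] neq *; lia.
Qed.

(** If the last boxes [i] and [j] differ, the path runs from [i :: s] to [i :: j :: r], by one swap
    to [j :: i :: r], and on to [j :: t]. Its outer parts fix the last box and come from the
    induction hypothesis for [fun w => P (a :: w)]. *)
Lemma std_word_connected (K : fieldType) (q : K) n (P : seq nat -> Prop) s t :
    q != 0 -> (forall m, (1 < m)%N -> q ^+ m != 1) ->
    std_word s -> std_word t -> perm_eq s t -> size s = n ->
    (forall k u, std_word u -> perm_eq u s -> (k.+1 < n)%N ->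
       swap_coef q (box q k u) (box q k.+1 u) != 0 -> P u -> P (swap_box k u)) ->
  P s -> P t.
Proof.
move=> q_neq0 q_gen; elim: n s t P => [|n IHn] s t P std_s std_t eq_st szs stepP Ps.
  have s0 := size0nil szs; rewrite s0 in eq_st Ps.
  by move: eq_st; rewrite perm_sym => /perm_nilP->.
have consP a u v : std_word (a :: u) -> std_word (a :: v) -> perm_eq (a :: u) s ->
    perm_eq u v -> P (a :: u) -> P (a :: v).
  move=> std_au std_av perm_u perm_uv.
  have /andP[std_u add_a] : std_word u && _ := std_au.
  have /andP[std_v _] : std_word v && _ := std_av.
  have szu : size u = n by have := perm_size perm_u; rewrite szs => -[].
  apply: (IHn _ _ (fun w => P (a :: w))) => // k w std_w perm_w ltkn bN0 Pw.
  have szw : size w = n by rewrite (perm_size perm_w).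
  rewrite -swap_box_cons ?szw //; apply: stepP => //.
  - by rewrite /= std_w !(seq.permP perm_w).
  - by apply: perm_trans perm_u; rewrite perm_cons.
  - exact: ltnW.
  by rewrite !box_cons ?szw // ltnW.
case: s std_s eq_st szs stepP Ps consP => // i s std_s eq_st [szs] stepP Ps consP.
case: t std_t eq_st => [|j t] std_t eq_st; first by have := perm_size eq_st.
have [eq_ij | neq_ij] := eqVneq i j.
  by rewrite eq_ij perm_cons in eq_st std_s Ps consP *; apply: consP Ps.
have js : j \in s.
  by have := perm_mem eq_st j; rewrite !inE eqxx eq_sym (negPf neq_ij).
have sE := perm_to_rem js.
have /andP[std_s' _] : std_word s && _ := std_s.
have /andP[std_t' _] : std_word t && _ := std_t.
have [r std_r perm_r] := std_word_ex (fun l => rem_count_mono l neq_ij std_s' std_t' eq_st).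
have perm_s : perm_eq (j :: r) s by rewrite perm_sym (perm_trans sE) // perm_cons perm_sym.
have perm_ij : perm_eq (i :: j :: r) (j :: i :: r).
  by rewrite (perm_catCA [:: i] [:: j] r).
have perm_t : perm_eq (i :: r) t.
  rewrite -(perm_cons j) -(permPl perm_ij); apply: perm_trans eq_st.
  by rewrite perm_cons.
have cnt_s := seq.permP perm_s; have cnt_t := seq.permP perm_t.
have std_j : std_word (j :: r).
  by apply: std_word_cons => // l; rewrite !cnt_s std_word_mono.
have std_i : std_word (i :: r).
  by apply: std_word_cons => // l; rewrite !cnt_t std_word_mono.
have std_ij : std_word (i :: j :: r).
  apply: std_word_cons => // l; have := std_word_mono std_s (leqnSn l).
  by rewrite /= -!cnt_s.
have std_ji : std_word (j :: i :: r).
  apply: std_word_cons => // l; have := std_word_mono std_t (leqnSn l).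
  by rewrite /= -!cnt_t.
have szr : (size r).+1 = n by have := perm_size perm_s; rewrite szs.
have Pij : P (i :: j :: r) by apply: consP Ps => //; rewrite perm_sym.
have Pji : P (j :: i :: r).
  rewrite -(swap_box_head i j (erefl (size r))); apply: stepP => //.
  - by rewrite perm_cons.
  - by rewrite -szr.
  exact: std_word_swap_coef.
by apply: consP Pji => //; rewrite -(permPl perm_ij) perm_cons.
Qed.

(** * Tableaux of a given shape *)

Lemma part_oversize n (la : intpart n) i : (n <= i)%N -> part la i = 0%N.
Proof. by move=> le_ni; rewrite /part nth_default // size_map size_tuple. Qed.

Lemma part_mono n (la : intpart n) i j : (i <= j)%N -> (part la j <= part la i)%N.
Proof.
move=> leij; case: (ltnP j n) => [ltjn | /part_oversize-> //].
have /andP[sorted_la _] := intpartP la.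
apply: (sorted_leq_nth (leT := geq)) => //; rewrite ?inE ?size_map ?size_tuple //.
- by move=> a b c /= leab lebc; apply: leq_trans lebc leab.
- by move=> a; apply: leqnn.
exact: leq_ltn_trans ltjn.
Qed.

Lemma sum_part n (la : intpart n) : (\sum_(i < n) part la i)%N = n.
Proof.
have /andP[_ /eqP sum_la] := intpartP la; rewrite -[RHS]sum_la.
rewrite sumnE (big_nth 0%N) big_mkord size_map size_tuple.
by apply: eq_bigr.
Qed.

Lemma part_inj n (la mu : intpart n) : (forall i, part la i = part mu i) -> la = mu.
Proof.
move=> eq_part; apply/val_inj/val_inj; apply: (inj_map val_inj).
apply: (@eq_from_nth _ 0%N); first by rewrite !size_map !size_tuple.
by move=> i _; apply: eq_part.
Qed.

Definition std_of (n : nat) (la : intpart n) : seq (seq nat) :=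
  [seq t <- std_words n | all (fun i => count_mem i t == part la i) (iota 0 n)].

Lemma std_words_count n t i : t \in std_words n -> (n <= i)%N -> count_mem i t = 0%N.
Proof.
rewrite mem_std_words => /andP[std_t /eqP <-] lt_ni.
by apply/count_memPn/negP=> /(std_word_lt std_t); rewrite ltnNge lt_ni.
Qed.

Lemma std_ofP n (la : intpart n) t :
  reflect (t \in std_words n /\ forall i, count_mem i t = part la i) (t \in std_of la).
Proof.
rewrite mem_filter andbC; apply: (iffP andP) => -[St cnt]; split=> //.
  move=> i; case: (ltnP i n) => [ltin | leni].
    by apply/eqP/(allP cnt); rewrite mem_iota.
  by rewrite part_oversize ?(std_words_count St).
by apply/allP=> i _; apply/eqP.
Qed.

Lemma std_of_ex n (la : intpart n) : exists t, t \in std_of la.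
Proof.
pose p := flatten [seq nseq (part la i) i | i <- iota 0 n].
have cnt_p i : count_mem i p = part la i.
  rewrite count_flatten -map_comp sumnE big_map /=.
  under eq_bigr => j _ do rewrite count_nseq.
  case: (ltnP i n) => [ltin | leni].
    rewrite (bigD1_seq i) ?mem_iota ?iota_uniq //= eqxx mul1n big1 ?addn0 // => j.
    by move/negPf->.
  rewrite part_oversize // big_seq big1 // => j; rewrite mem_iota /= => ltjn.
  by rewrite /= (_ : (j == i) = false) //; lia.
have [i | t std_t perm_t] := @std_word_ex p.
  by rewrite !cnt_p part_mono.
exists t; apply/std_ofP; split=> [|i]; last by rewrite -cnt_p (seq.permP perm_t).
rewrite mem_std_words std_t (perm_size perm_t) size_flatten sumnE /shape -map_comp.
apply/eqP; rewrite big_map -[RHS](sum_part la) -(big_mkord predT (part la)).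
by rewrite /index_iota subn0; apply: eq_bigr => i _; rewrite /= size_nseq.
Qed.

Lemma shape_ex n t : t \in std_words n -> exists la : intpart n, t \in std_of la.
Proof.
move=> St; have /[!mem_std_words]/andP[std_t /eqP szt] := St.
have lt_cnt i : (count_mem i t < n.+1)%N by rewrite ltnS -szt count_size.
pose v := [tuple Ordinal (lt_cnt i) | i < n].
have vE : map val v = [seq count_mem i t | i <- iota 0 n].
  by rewrite /= -map_comp -val_enum_ord -map_comp; apply: eq_map.
have vP : sorted geq (map val v) && (sumn (map val v) == n).
  rewrite vE; apply/andP; split.
    apply: (homo_sorted (e := leq)); last exact: iota_sorted.
    by move=> i j leij; apply: std_word_mono.
  apply/eqP; rewrite sumnE big_map -[RHS]szt -sum1_size.
  rewrite (eq_big_seq (fun i => \sum_(j <- t) (j == i))%N); last first.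
    by move=> i _; rewrite -sum1_count big_mkcond /=; apply: eq_bigr => j _; case: eqP.
  rewrite exchange_big /=; apply: eq_big_seq => j tj.
  rewrite (bigD1_seq j) ?iota_uniq ?mem_iota /= -?szt ?(std_word_lt std_t) //.
  rewrite eqxx big1 ?addn0 // => i; by rewrite eq_sym => /negPf->.
exists (IntPart vP); apply/std_ofP; split=> // i.
rewrite /part /parts [intpart_val _]/= vE.
case: (ltnP i n) => [ltin | leni].
  by rewrite (nth_map 0%N) ?size_iota // nth_iota.
by rewrite nth_default ?size_map ?size_iota // (std_words_count St).
Qed.

Lemma std_of_inj n (la mu : intpart n) t : t \in std_of la -> t \in std_of mu -> la = mu.
Proof.
move=> /std_ofP[_ la_t] /std_ofP[_ mu_t]; apply: part_inj => i.
by rewrite -la_t mu_t.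
Qed.

Section StdOf.
Variables (K : fieldType) (q : K).
Hypotheses (q_neq0 : q != 0) (q_generic : forall m, (1 < m)%N -> q ^+ m != 1).

Lemma std_of_stable n (la : intpart n) : stable q n (std_of la).
Proof.
have [uniqS _ closedS] := std_words_stable q_neq0 q_generic n.
split; first by rewrite filter_uniq.
  by move=> t /std_ofP[].
move=> k t /std_ofP[St la_t] ltkn bN0; apply/std_ofP; split.
  exact: closedS.
by move=> i; rewrite count_swap_box.
Qed.

Lemma std_of_connected N (la : intpart N.+1) : swap_connected q N (std_of la).
Proof.
move=> P stepP s t /std_ofP[Ss la_s] /std_ofP[St la_t].
have /[!mem_std_words]/andP[std_s /eqP szs] := Ss.
have /[!mem_std_words]/andP[std_t /eqP szt] := St.
apply: (std_word_connected q_neq0 q_generic std_s std_t _ szs).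
  by apply/allP=> i _; rewrite /= la_s la_t.
move=> k u std_u perm_u ltkN bN0; apply: stepP => //.
apply/std_ofP; split; first by rewrite mem_std_words std_u (perm_size perm_u) szs eqxx.
by move=> i; rewrite (seq.permP perm_u).
Qed.

Lemma sum_std_words n (V : nmodType) (F : seq nat -> V) :
  \sum_(t <- std_words n) F t = \sum_(la : intpart n) \sum_(t <- std_of la) F t.
Proof.
under [RHS]eq_bigr => la _ do rewrite big_filter big_mkcond.
rewrite exchange_big /=; apply: eq_big_seq => t St.
have [la la_t] := shape_ex St.
have shapeE mu : all (fun i => count_mem i t == part mu i) (iota 0 n) = (mu == la).
  have := mem_filter (fun s => all (fun i =>
    count_mem i s == part mu i) (iota 0 n)) t (std_words n).
  rewrite St andbT => <-; apply/idP/eqP => [mu_t | -> //].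
  exact: std_of_inj mu_t la_t.
rewrite (bigD1 la) //= shapeE eqxx big1 ?addr0 // => mu neq_mu.
by rewrite shapeE (negPf neq_mu).
Qed.

End StdOf.

(** * Branching *)

Lemma sum_std_wordsS (V : nmodType) n (F : seq nat -> V) :
  \sum_(t <- std_words n.+1) F t =
  \sum_(s <- std_words n) \sum_(i <- addable s) F (i :: s).
Proof. by rewrite big_allpairs_dep. Qed.

Lemma remove_nodeP n (la : intpart n.+1) (mu : intpart n) :
  reflect (exists i, forall j, part la j = (part mu j + (j == i))%N) (remove_node la mu).
Proof.
apply: (iffP existsP) => [[i /forallP eq_la] | [i eq_la]].
  exists (val i) => j; case: (ltnP j n.+1) => [ltjn | lenj].
    by have /eqP := eq_la (Ordinal ltjn); rewrite -val_eqE.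
  rewrite !part_oversize ?(ltnW lenj) // (gtn_eqF (leq_trans (ltn_ord i) lenj)) //.
have ltin : (i < n.+1)%N.
  rewrite ltnNge; apply/negP=> leni; have := eq_la i.
  by rewrite eqxx part_oversize // addn1.
by exists (Ordinal ltin); apply/forallP=> j; rewrite eq_la -val_eqE.
Qed.

Lemma std_of_remove n (la : intpart n.+1) (mu : intpart n) s i :
  s \in std_of mu -> i :: s \in std_of la ->
  forall j, part la j = (part mu j + (j == i))%N.
Proof.
move=> /std_ofP[_ mu_s] /std_ofP[_ la_is] j.
by rewrite -la_is -mu_s /= addnC eq_sym.
Qed.

(** Both sides are rewritten as sums over the standard words [s] of length [n]: such an [s] has at
    most one extension of shape [la], and has one exactly if its shape lies below [la]. *)
Lemma sum_std_of_branch (V : nmodType) n (la : intpart n.+1) (F : seq nat -> V) :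
  \sum_(t <- std_of la) F (behead t) =
  \sum_(mu : intpart n | remove_node la mu) \sum_(s <- std_of mu) F s.
Proof.
have in_std (m : nat) (nu : intpart m) t : t \in std_words m ->
    all (fun i => count_mem i t == part nu i) (iota 0 m) = (t \in std_of nu).
  by move=> St; rewrite mem_filter St andbT.
transitivity (\sum_(s <- std_words n) \sum_(mu | remove_node la mu)
    if s \in std_of mu then F s else 0); last first.
  rewrite exchange_big /=; apply: eq_bigr => mu _.
  rewrite [RHS]big_filter [RHS]big_mkcond; apply: eq_big_seq => s Ss.
  by rewrite (in_std _ mu).
rewrite big_filter big_mkcond sum_std_wordsS; apply: eq_big_seq => s Ss.
have [mu mu_s] := shape_ex Ss; have /std_ofP[_ cnt_s] := mu_s.
have /[!mem_std_words]/andP[std_s /eqP szs] := Ss.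
have only_mu nu : (s \in std_of nu) = (nu == mu).
  by apply/idP/eqP => [nu_s | -> //]; apply: std_of_inj nu_s mu_s.
have in_add i : i \in addable s ->
    all (fun j => count_mem j (i :: s) == part la j) (iota 0 n.+1) = (i :: s \in std_of la).
  move=> add_i; apply: in_std.
  by rewrite mem_std_words mem_addable std_s add_i /= szs.
transitivity (if remove_node la mu then F s else 0).
  rewrite (eq_big_seq (fun i => if i :: s \in std_of la then F s else 0)); last first.
    by move=> i add_i; rewrite in_add.
  case: remove_nodeP => [[i eq_la] | no_i].
    have la_is : i :: s \in std_of la.
      have std_is : std_word (i :: s).
        apply: std_word_cons => // j.
        have cntE k : count_mem k (i :: s) =
          part la k by rewrite eq_la -cnt_s /= addnC eq_sym.
        by rewrite !cntE part_mono.
      apply/std_ofP; split; first by rewrite mem_std_words std_is /= szs eqxx.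
      by move=> k; rewrite eq_la -cnt_s /= addnC eq_sym.
    have add_i : i \in addable s.
      case/std_ofP: la_is => /[!mem_std_words]/andP[].
      by rewrite mem_addable => /andP[].
    rewrite (bigD1_seq i) ?filter_uniq ?iota_uniq //= la_is big1 ?addr0 // => j neq_ji.
    case: ifP => // la_js; have := std_of_remove mu_s la_js i; rewrite eq_la eqxx.
    by rewrite eq_sym (negPf neq_ji) => /addnI.
  apply: big1 => i _; case: ifP => // la_is; case: no_i; exists i.
  exact: std_of_remove mu_s la_is.
case: (boolP (remove_node la mu)) => rem_mu; last first.
  rewrite big1 // => nu rem_nu; rewrite only_mu; case: eqP => // eq_nu.
  by rewrite -eq_nu rem_nu in rem_mu.
rewrite (bigD1 mu) //= only_mu eqxx big1 ?addr0 // => nu /andP[_ neq_nu].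
by rewrite only_mu (negPf neq_nu).
Qed.

(** The partition is obtained as the shape of a tableau: a letter [i] is deleted and the remaining
    letters are rearranged into a standard word. *)
Lemma corner_remove n (la : intpart n.+1) i : (part la i.+1 < part la i)%N ->
  exists mu : intpart n, forall j, part la j = (part mu j + (j == i))%N.
Proof.
move=> corner; have [t /std_ofP[/[!mem_std_words]/andP[std_t /eqP szt] la_t]] :=
  std_of_ex la.
have ti : i \in t by rewrite -has_pred1 has_count la_t; apply: leq_ltn_trans corner.
have cntE j : part la j = ((i == j) + count_mem j (rem i t))%N.
  by rewrite -la_t (seq.permP (perm_to_rem ti)).
have [j | r std_r perm_r] := @std_word_ex (rem i t).
  have := part_mono la (leqnSn j); have := cntE j; have := cntE j.+1.
  case: (i =P j) corner => [-> | _] corner; last by case: (i =P j.+1) => _; lia.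
  by rewrite (ltn_eqF (ltnSn j)) /=; lia.
have Sr : r \in std_words n.
  by rewrite mem_std_words std_r (perm_size perm_r) size_rem // szt eqxx.
have [mu /std_ofP[_ mu_r]] := shape_ex Sr; exists mu => j.
by rewrite cntE -mu_r (seq.permP perm_r) addnC eq_sym.
Qed.

Lemma remove_node_ex n (la : intpart n.+1) : exists mu, remove_node la mu.
Proof.
have [[|i s] la_t] := std_of_ex la;
  have /std_ofP[/[!mem_std_words]/andP[std_t szt] _] := la_t.
  by [].
have [|mu mu_s] := @shape_ex n s.
  by rewrite mem_std_words -eqSS szt andbT; have /andP[] : std_word s && _ := std_t.
by exists mu; apply/remove_nodeP; exists i; apply: std_of_remove mu_s la_t.
Qed.

(** If [la] and [la'] arise from [mu] by nodes in different rows, neither has a further corner, so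
    both are rectangles. Rectangles differing by one moved node are (2) and (1,1), which [1 < n]
    excludes. *)
Lemma remove_node_inj n (la la' : intpart n.+1) : (1 < n)%N ->
  remove_node la =1 remove_node la' -> la = la'.
Proof.
move=> lt1n eq_rem; have [mu rem_mu] := remove_node_ex la.
have rem_mu' := rem_mu; rewrite eq_rem in rem_mu'.
case/remove_nodeP: rem_mu => i la_i; case/remove_nodeP: rem_mu' => i' la_i'.
have [eq_ii' | neq_ii'] := eqVneq i i'.
  by apply: part_inj => j; rewrite la_i la_i' eq_ii'.
wlog lt_ii' : la la' i i' eq_rem la_i la_i' neq_ii' / (i < i')%N.
  move=> IH; case: (ltngtP i i') neq_ii' => // lt_ii' _.
    by apply: (IH la la' i i') => //; rewrite neq_ltn lt_ii'.
  by apply/esym/(IH la' la i' i) => //; rewrite neq_ltn lt_ii'.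
(* Removing a corner of [nu] outside row [k] would keep the node added in row [k], for which [nu']
   has no room. *)
have flat (nu nu' : intpart n.+1) k k' : remove_node nu =1 remove_node nu' ->
    (forall j, part nu j = part mu j + (j == k))%N ->
    (forall j, part nu' j = part mu j + (j == k'))%N -> k != k' ->
    forall j, j != k -> part nu j.+1 = part nu j.
  move=> eq_nu nu_k nu_k' neq_kk' j neq_jk; apply/eqP; rewrite eqn_leq part_mono //=.
  rewrite leqNgt; apply/negP=> /corner_remove[mu' nu_j].
  have /remove_nodeP[l nu'_l] : remove_node nu' mu'.
    by rewrite -eq_nu; apply/remove_nodeP; exists j.
  have := nu_j k; rewrite (nu_k k) (eq_sym k j) (negPf neq_jk).
  have := nu'_l k; rewrite (nu_k' k) (negPf neq_kk') eqxx; lia.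
have flat_la := flat la la' i i' eq_rem la_i la_i' neq_ii'.
have neq_i'i : i' != i by rewrite eq_sym.
have flat_la' := flat la' la i' i (fun nu => esym (eq_rem nu)) la_i' la_i neq_i'i.
have la_const j : (i < j)%N -> part la j = 0%N.
  move=> lt_ij; have const d : part la (j + d) = part la j.
    elim: d => [|d IHd]; first by rewrite addn0.
    by rewrite addnS flat_la ?IHd //; lia.
  by rewrite -(const n.+1) part_oversize //; lia.
have la'_const j : (j <= i')%N -> part la' j = part la' i'.
  move=> leji'; rewrite -(subKn leji'); move: (i' - j)%N (leq_subr j i').
  elim=> [|d IHd] ledi'; first by rewrite subn0.
  rewrite -flat_la'; last by lia.
  by rewrite (_ : (i' - d.+1).+1 = i' - d)%N ?IHd //; lia.
(* Since [la] is empty below row [i], row [i'] of [la'] is a single node. Hence [la'] is a column,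
   [mu] is one too, and [la] can only be (2). *)
have la'1 : part la' i' = 1%N.
  by have := la_i i'; rewrite la_i' (negPf neq_i'i) la_const // eqxx; lia.
have neq0i' : (0%N == i') = false by rewrite ltn_eqF // (leq_ltn_trans _ lt_ii').
have mu0 : part mu 0 = 1%N by have := la_i' 0%N; rewrite la'_const // la'1 neq0i' addn0.
have i0 : i = 0%N.
  case: (posnP i) => // lt0i.
  have mui : part mu i = 1%N.
    by have := la_i' i; rewrite la'_const ?la'1 ?(negPf neq_ii') ?addn0 // ltnW.
  by have := part_mono la (leq0n i); rewrite !la_i mu0 mui eqxx ltn_eqF.
have := sum_part la; rewrite big_ord_recl big1 ?addn0 => [|j _]; last first.
  by apply: la_const; rewrite i0.
by rewrite la_i mu0 i0 eqxx => -[n1]; rewrite -n1 in lt1n.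
Qed.

(** * Identification of the labelled characters *)

Lemma mxtrace_eq_normal (K : fieldType) (q : K) N (H : heckeAlgebra q N.+1) d e
    (rho : {lrmorphism H -> 'M[K]_d.+1}) (sigma : {lrmorphism H -> 'M[K]_e.+1}) :
    (forall v, v \in normal_words N ->
      \tr (rho (\prod_(k <- v) hgen H k)) = \tr (sigma (\prod_(k <- v) hgen H k))) ->
  forall h, \tr (rho h) = \tr (sigma h).
Proof.
move=> eq_tr h; rewrite (hecke_expand h) !linear_sum; apply: eq_bigr => w _.
by rewrite !linearZ /= eq_tr //; have [] := normal_wordP w.
Qed.

Section Labelling.
Variables (K : fieldType) (q : K).
Hypotheses (q_neq0 : q != 0) (q_generic : forall m, (1 < m)%N -> q ^+ m != 1).

Lemma theta_eq n k f g s : size s = n ->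
  (forall r, size r = n -> f r = g r) -> theta q k f s = theta q k g s.
Proof. by move=> szs eq_fg; rewrite /theta !eq_fg ?size_swap_box. Qed.

(** Restriction to the smaller algebra: its generators move only boxes below the last one. *)
Lemma thetas_cons n u f i s : size s = n -> all (fun k => (k.+1 < n)%N) u ->
  thetas q u f (i :: s) = thetas q u (fun r => f (i :: r)) s.
Proof.
elim: u s => //= k u IHu s szs /andP[ltkn all_u].
rewrite -(theta_eq k szs (fun r szr => IHu r szr all_u)) /theta.
by rewrite swap_box_cons ?box_cons ?szs // ltnW.
Qed.

Lemma thetas_ext u f g s : f =1 g -> thetas q u f s = thetas q u g s.
Proof. by move=> eq_fg; elim: u s => //= k u IHu s; rewrite /theta !IHu. Qed.

Definition std_char (n : nat) (la : intpart n) (u : seq nat) : K :=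
  \sum_(t <- std_of la) thetas q u (delta K t) t.

Lemma std_char_branch n (la : intpart n.+1) u : all (fun k => (k.+1 < n)%N) u ->
  std_char la u = \sum_(mu | remove_node la mu) std_char mu u.
Proof.
move=> all_u; rewrite /std_char.
rewrite -(sum_std_of_branch la (fun s => thetas q u (delta K s) s)).
apply: eq_big_seq => -[|i s] /std_ofP[/[!mem_std_words]/andP[_ //] /eqP[szs] _].
rewrite (thetas_cons _ _ szs) //; apply: thetas_ext => r.
by rewrite /delta eqseq_cons eqxx.
Qed.

Lemma affords_trace N (H : heckeAlgebra q N.+1) (la : intpart N.+1) d
    (rho : {lrmorphism H -> 'M[K]_d.+1}) u :
    affords (std_of la) rho -> all (fun k => (k < N)%N) u ->
  \tr (rho (\prod_(k <- u) hgen H k)) = std_char la u.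
Proof.
move=> aff all_u; rewrite (affords_word aff) //.
by have [_ szS _] := aff; rewrite (trace_mx_of szS).
Qed.

Lemma std_of_affords N (H : heckeAlgebra q N.+1) (la : intpart N.+1) :
  exists d (rho : {lrmorphism H -> 'M[K]_d.+1}), affords (std_of la) rho.
Proof.
have [t la_t] := std_of_ex la.
have szS : size (std_of la) = (size (std_of la)).-1.+1.
  by rewrite prednK //; case: (std_of la) la_t.
exists (size (std_of la)).-1.
exact: (affords_ex q_neq0 q_generic H (std_of_stable q_neq0 q_generic la) szS).
Qed.

Variables (H : forall n : nat, heckeAlgebra q n)
  (chi : forall n : nat, intpart n -> H n -> K).
Hypothesis chiP : standard_labelling chi.

Lemma labelling_mxtrace N (la : intpart N.+1) :
  exists d (rho : {lrmorphism H N.+1 -> 'M[K]_d.+1}), forall h, chi la h = \tr (rho h).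
Proof. by have [d [rho [_ rhoE]]] := labelling_irr chiP la (ltn0Sn N); exists d, rho. Qed.

Definition labels_shape N : Prop :=
  forall (la : intpart N.+1) d (rho : {lrmorphism H N.+1 -> 'M[K]_d.+1}),
    affords (std_of la) rho -> forall h, chi la h = \tr (rho h).

(** All elements of [H 1] are scalars, so every line is stable and an irreducible representation has
    dimension 1. *)
Lemma labelling_shape1 : labels_shape 0.
Proof.
move=> la d rho [stS szS _].
have d0 : d = 0%N.
  case: stS => uniqS subS _; have := uniq_leq_size uniqS subS.
  by rewrite szS ltnS leqn0 => /eqP.
subst d.
have scal (h : H 1%N) : exists c, h = c%:A.
  exists (hecke_coef 1%g h); rewrite {1}(hecke_expand h) (bigD1 1%g) //= [X in _ +
    X]big1 => [|w].
    have nw1 : normal_word (1%g : 'S_1) = [::].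
      by have [Nw _] := normal_wordP (1%g : 'S_1); apply/eqP; move: Nw; rewrite mem_seq1.
    by rewrite nw1 big_nil addr0.
  by rewrite permS1 eqxx.
have [e [sigma [irr_sigma sigmaE]]] := labelling_irr chiP la (ltn0Sn 0).
have e0 : e = 0%N.
  have stab a : stablemx (delta_mx 0 0 : 'M[K]_e.+1) (sigma a).
    have [c ->] := scal a.
    by rewrite linearZ rmorph1 /= -scalemxAr mulmx1 scalemx_sub.
  have nz : (delta_mx 0 0 : 'M[K]_e.+1) != 0.
    by apply/matrix0Pn; exists 0, 0; rewrite mxE !eqxx oner_eq0.
  by have := irr_sigma _ stab nz; rewrite /row_full mxrank_delta eqSS => /eqP <-.
subst e; move=> h; have [c ->] := scal h.
by rewrite sigmaE !linearZ !rmorph1 /= !mxtrace1.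
Qed.

Lemma labelling_branch_trace N (la : intpart N.+2) d
    (rho : {lrmorphism H N.+2 -> 'M[K]_d.+1}) h :
    labels_shape N -> affords (std_of la) rho ->
  \tr (rho (hecke_incl (H N.+2) h)) = \sum_(mu | remove_node la mu) chi mu h.
Proof.
move=> labN aff; rewrite hecke_inclE linear_sum linear_sum /=.
have chiE mu : chi mu h =
    \sum_(w : 'S_N.+1) hecke_coef w h * std_char mu (normal_word w).
  have [e [sigma sigma_mu]] := std_of_affords (H N.+1) mu.
  rewrite (labN _ _ _ sigma_mu) {1}(hecke_expand h) linear_sum linear_sum /=.
  apply: eq_bigr => w _; rewrite !linearZ /= (affords_trace sigma_mu) //.
  by have [Nw _] := normal_wordP w; apply: normal_words_lt.
under [RHS]eq_bigr => mu _ do rewrite chiE.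
rewrite [RHS]exchange_big /=; apply: eq_bigr => w _; rewrite -mulr_sumr.
have [Nw _] := normal_wordP w.
rewrite !linearZ /= (affords_trace aff) ?std_char_branch //.
  exact: normal_words_lt.
exact/normal_words_lt/normal_wordsS.
Qed.

(** The prescribed values at [T_1] distinguish the two labels; the value at 1 comes from size 1 by
    branching. *)
Lemma labelling_shape2 : labels_shape 1.
Proof.
move=> la d rho aff; have [stS szS rhoE] := aff.
have [e [sigma sigmaE]] := labelling_mxtrace la.
move=> h; rewrite sigmaE; apply: mxtrace_eq_normal => v; rewrite -sigmaE.
have -> : normal_words 1 = [:: [:: 0%N]; [::]] by [].
rewrite !inE => /orP[]/eqP->; last first.
  rewrite big_nil -(hecke_incl1 (H 1) (H 2)).
  by rewrite (labelling_branch chiP) // (labelling_branch_trace _ labelling_shape1 aff).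
have q1_neq0 : q - 1 != 0 by rewrite subr_eq0 -(expr1 q) q_exp_neq1.
rewrite (affords_trace aff) // big_seq1 /std_char.
have -> : hgen (H 2) 0 = hecke_T (H 2) (@stransp 2 ord0).
  by rewrite /hgen (gen_atE _ _ (ltn0Sn 0)); congr (hecke_T _ (stransp _)); apply: val_inj.
have partsE : parts la = [:: part la 0; part la 1].
  apply: (@eq_from_nth _ 0%N); first by rewrite size_map size_tuple.
  by rewrite size_map size_tuple => -[|[|[]]].
have std2 : std_words 2 = [:: [:: 0; 0]; [:: 1; 0]]%N by [].
have [t la_t] := std_of_ex la; have /std_ofP[] := la_t.
rewrite std2 !inE => /orP[]/eqP-> cnt.
  have [p0 p1] : part la 0 = 2%N /\ part la 1 = 0%N by rewrite -!cnt.
  rewrite (labelling_row2 chiP) ?partsE ?p0 ?p1 // /std_of std2 /= p0 p1 /= big_seq1.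
  rewrite /thetas /= /theta /= /content /= expr0 expr1 !divr1 /swap_coef mulr1 eqxx.
  by rewrite !mul0r addr0 /diag_coef /delta eqxx mulr1 mulrAC mulfV ?mul1r.
have [p0 p1] : part la 0 = 1%N /\ part la 1 = 1%N by rewrite -!cnt.
rewrite (labelling_col2 chiP) ?partsE ?p0 ?p1 // /std_of std2 /= p0 p1 /= big_seq1.
rewrite /thetas /= /theta /= /content /= expr0 expr1 divr1 div1r.
rewrite /delta eqxx mulr1 mulr0 addr0 /diag_coef.
have ? : 1 - q != 0 by rewrite -opprB oppr_eq0.
by field; rewrite q_neq0 mulN1r.
Qed.

(** By irreducibility [rho] has some label [la']. For [h] the diagonal unit of a tableau of shape
    [mu], the branching sum at [h] is the indicator of [mu] lying below the label; computed for
    [rho] as well, it shows that [la] and [la'] have the same partitions below them. *)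
Lemma labelling_shapeS N : labels_shape N.+1 -> labels_shape N.+2.
Proof.
move=> labN la d rho aff.
have irr_rho := affords_irreducible q_neq0 q_generic aff (@std_of_connected _ _ q_neq0
  q_generic _ la).
have [|la' chi_la'] := labelling_surj chiP (f := fun h => \tr (rho h)) (ltn0Sn N.+2).
  by exists d, rho.
suff <- : la' = la by move=> h; rewrite chi_la'.
apply: remove_node_inj => // mu.
have [t mu_t] := std_of_ex mu; have /std_ofP[St _] := mu_t.
have [h hE] := diagonal_delta q_neq0 q_generic (H N.+2) St.
have chi_h nu : chi nu h = (nu == mu)%:R.
  have [e [sigma aff_nu]] := std_of_affords (H N.+2) nu; have [stS szS _] := aff_nu.
  rewrite (labN _ _ _ aff_nu) (hE _ _ _ aff_nu) (trace_mx_of szS) /delta.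
  have [-> | neq_nu] := eqVneq nu mu.
    case: (std_of_stable q_neq0 q_generic mu) => uniqS _ _.
    by rewrite (bigD1_seq t) //= !eqxx mulr1 big1 ?addr0 // => s /negPf->; rewrite mul0r.
  rewrite big_seq big1 // => s nu_s; rewrite eqxx mulr1; case: eqP => // eq_st.
  by rewrite eq_st in nu_s; rewrite (std_of_inj nu_s mu_t) eqxx in neq_nu.
have sum_h (nu : intpart N.+3) : \sum_(kappa | remove_node nu kappa) chi kappa h =
    (remove_node nu mu)%:R.
  under eq_bigr => kappa _ do rewrite chi_h.
  case: (boolP (remove_node nu mu)) => rem; last first.
    by rewrite big1 // => kappa rem_k; case: eqP => // eq_k; rewrite -eq_k rem_k in rem.
  rewrite (bigD1 mu) //= eqxx big1 ?addr0 // => kappa /andP[_ /negPf->].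
  by [].
have := labelling_branch chiP la' h (ltn0Sn N.+1); rewrite sum_h.
rewrite -chi_la' (labelling_branch_trace _ labN aff) sum_h.
case: (remove_node la mu); case: (remove_node la' mu) => // /eqP.
  by rewrite oner_eq0.
by rewrite eq_sym oner_eq0.
Qed.

Lemma labelling_shape N : labels_shape N.
Proof.
case: N => [|N]; first exact: labelling_shape1.
by elim: N => [|N IHN]; [exact: labelling_shape2 | exact: labelling_shapeS].
Qed.
End Labelling.

(** * The hook weights *)

(** The sum is the coefficient of degree [m] in the interpolation formula for [p], whose size is at
    most [m]. *)
Lemma lagrange_sum (K : fieldType) m (x : 'I_m.+1 -> K) (p : {poly K}) :
  injective x -> (size p <= m)%N ->
  \sum_i p.[x i] / \prod_(j < m.+1 | j != i) (x i - x j) = 0.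
Proof.
move=> inj_x szp; pose c i := p.[x i] / \prod_(j < m.+1 | j != i) (x i - x j).
pose b i := \prod_(j < m.+1 | j != i) ('X - (x j)%:P).
have b_size i : size (b i) = m.+1.
  rewrite /b -big_filter size_prod_XsubC; have [e _ _ [_ ->]] := big_enumP.
  by rewrite cardC1 card_ord.
have prod_neq0 i : \prod_(j < m.+1 | j != i) (x i - x j) != 0.
  apply/prodf_neq0 => j neq_ji; rewrite subr_eq0.
  by apply: contra neq_ji => /eqP/inj_x->.
have pE : p = \sum_i c i *: b i.
  apply/eqP; rewrite -subr_eq0; apply/eqP/(@roots_geq_poly_eq0 _ _ (codom x)).
  - apply/allP=> _ /codomP[i ->]; rewrite rootE hornerD hornerN horner_sum.
    rewrite (bigD1 i) //= big1 => [|l neq_li].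
      by rewrite addr0 hornerZ horner_prod; under eq_bigr => j _ do rewrite hornerXsubC;
        rewrite divfK ?subrr.
    rewrite hornerZ horner_prod (bigD1 i) /=; last by rewrite eq_sym.
    by rewrite hornerXsubC subrr mul0r mulr0.
  - by rewrite map_inj_uniq ?enum_uniq.
  rewrite size_codom card_ord (leq_trans (size_polyD _ _)) // size_polyN geq_max (leqW
    szp) /=.
  apply: leq_trans (size_sum _ _ _) _; apply/bigmax_leqP => i _.
  by apply: leq_trans (size_scale_leq _ _) _; rewrite b_size.
have := congr1 (fun r : {poly K} => r`_m) pE; rewrite /= nth_default // coef_sum => /esym.
rewrite (eq_bigr c) // => i _; rewrite coefZ.
have /monicP := monic_prod_XsubC (index_enum 'I_m.+1) (fun j => j != i) x.
rewrite lead_coefE -/(b i) b_size /= => ->.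
by rewrite mulr1.
Qed.

Section HookRow.
Variables (n : nat) (la : intpart n).

Definition leg (i c : nat) : nat :=
  count (fun j => (c < part la j)%N) (iota i.+1 (n - i.+1)).

Lemma part_le i : (part la i <= n)%N.
Proof.
case: (ltnP i n) => [ltin | /part_oversize-> //].
rewrite -[leqRHS](sum_part la) (bigD1 (Ordinal ltin)) //=; exact: leq_addr.
Qed.

Lemma leg_ge i j c : (i < j)%N -> (j < n)%N -> (c < part la j)%N -> (j - i <= leg i c)%N.
Proof.
move=> lt_ij lt_jn lt_cj; rewrite /leg.
have -> : (n - i.+1 = (j - i) + (n - j.+1))%N by lia.
rewrite iotaD count_cat; apply: leq_trans (leq_addr _ _).
rewrite (_ : count _ _ = (j - i)%N) // -[RHS](size_iota i.+1); apply/eqP.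
rewrite -all_count; apply/allP=> l; rewrite mem_iota => lt_l.
by apply: leq_trans lt_cj _; apply: part_mono; lia.
Qed.

Lemma leg_lt i j c : (i < j)%N -> (j < n)%N -> (part la j <= c)%N -> (leg i c < j - i)%N.
Proof.
move=> lt_ij lt_jn le_jc; rewrite /leg.
have -> : (n - i.+1 = (j - i.+1) + (n - j))%N by lia.
rewrite iotaD count_cat.
have -> : count (fun l => (c < part la l)%N) (iota (i.+1 + (j - i.+1)) (n - j)) = 0%N.
  apply/eqP; rewrite -leqn0 leqNgt -has_count; apply/hasPn=> l; rewrite mem_iota => lt_l.
  rewrite -leqNgt; apply: leq_trans le_jc; apply: part_mono; lia.
rewrite addn0; apply: leq_ltn_trans (count_size _ _) _; rewrite size_iota; lia.
Qed.

Lemma leg_mono i c c' : (c <= c')%N -> (leg i c' <= leg i c)%N.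
Proof. by move=> le_cc'; apply: sub_count => j; apply: leq_ltn_trans. Qed.

(** The node itself is counted with the arm, hence no extra 1. *)
Lemma hook_lengthE (x : 'I_n * 'I_n) : x \in diagram la ->
  hook_length la x = (part la x.1 - x.2 + leg x.1 x.2)%N.
Proof.
case: x => i c; rewrite inE /= => lt_ci.
have -> : hook_length la (i, c) =
    (#|[set c' : 'I_n | c <= c' < part la i]| + #|[set i' : 'I_n | (i < i') &&
      (c < part la i')]|)%N.
  rewrite -(card_imset _ (fun a b (e : (i, a) = (i, b)) => congr1 snd e)).
  rewrite -(card_imset [set i' : 'I_n | _] (fun a b (e : (a, c) = (b, c)) => congr1 fst e)).
  rewrite -cardsUI [_ :&: _](_ : _ = set0) ?cards0 ?addn0; last first.
    apply/setP=> y; rewrite !inE; apply/andP=> -[/imsetP[c' _ ->] /imsetP[i']].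
    by rewrite inE => /andP[lt_ii' _] [eq_ii' _]; rewrite eq_ii' ltnn in lt_ii'.
  apply: eq_card => -[i' c']; rewrite !inE /=; apply/andP/orP.
    case=> lt_c' /orP[/andP[/eqP eq_i le_c] | /andP[/eqP eq_c le_i]].
      left; apply/imsetP; exists c'; last by rewrite eq_i.
      by rewrite inE le_c -eq_i.
    move: le_i; rewrite leq_eqVlt => /predU1P[eq_i | lt_i].
      left; apply/imsetP; exists c'; last by rewrite (val_inj eq_i).
      by rewrite inE eq_c leqnn eq_i -eq_c.
    right; apply/imsetP; exists i'; last by rewrite eq_c.
    by rewrite inE lt_i -eq_c.
  case=> /imsetP[d]; rewrite inE => /andP[le_d lt_d] [-> ->]; split=> //.
    by rewrite eqxx le_d.
  by rewrite eqxx (ltnW le_d) orbT.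
congr (_ + _)%N; rewrite cardsE -sum1_card.
  rewrite -(big_mkord (fun c' => c <= c' < part la i)%N (fun=> 1%N)).
  rewrite (eq_bigl (fun c' => (c' < part la i) && (c <= c'))%N); last by move=> c';
    rewrite andbC.
  rewrite -(big_nat_widenl c 0 n) // -(big_nat_widen c (part la i) n predT) ?part_le //.
  by rewrite sum_nat_const_nat muln1.
rewrite /leg -sum1_count -(big_mkord (fun i' =>
  (i < i') && (c < part la i'))%N (fun=> 1%N)).
rewrite (eq_bigl (fun i' => (c < part la i') && (i < i'))%N); last by move=> i';
  rewrite andbC.
by rewrite -(big_nat_widenl i.+1 0 n).
Qed.
End HookRow.

(** The beta-numbers of [c] taken with [k] rows; they decrease strictly for a partition. *)
Definition beta (k : nat) (c : nat -> nat) (i : nat) : nat := (c i + (k.-1 - i))%N.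

Lemma beta_lt k c i j : (forall a b, (a <= b)%N -> (c b <= c a)%N) ->
  (i < j)%N -> (j < k)%N -> (beta k c j < beta k c i)%N.
Proof. by move=> mono lt_ij lt_jk; have := mono i j (ltnW lt_ij); rewrite /beta; lia. Qed.

(** Both lists are duplicate-free, and they are disjoint: [leg la i c] is at least
    [j - i] or less than [j - i] according as [c < part la j] or not. *)
Lemma row_hooks n (la : intpart n) i : (i < n)%N ->
  perm_eq ([seq (part la i - c + leg la i c)%N | c <- iota 0 (part la i)]
           ++ [seq (beta n (part la) i - beta n (part la) j)%N | j <- iota i.+1 (n - i.+1)])
          (iota 1 (beta n (part la) i)).
Proof.
move=> lt_in; set s := _ ++ _.
have beta_ltn := beta_lt (part_mono la).
have le_beta j : (i <= j)%N -> (j < n)%N ->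
    beta n (part la) j = (part la j + (n.-1 - j))%N /\ (part la j <= part la i)%N.
  by move=> le_ij lt_jn; rewrite part_mono.
have uniq_s : uniq s.
  rewrite cat_uniq; apply/and3P; split.
  - rewrite map_inj_in_uniq ?iota_uniq // => c c';
    rewrite !mem_iota !add0n /= => lt_c lt_c'.
    have [lt_cc' | lt_c'c | //] := ltngtP c c'.
      by have := leg_mono la i (ltnW lt_cc'); lia.
    by have := leg_mono la i (ltnW lt_c'c); lia.
  - apply/hasPn=> _ /mapP[j + ->]; rewrite mem_iota => lt_j; apply/mapP=> -[c].
    rewrite mem_iota add0n /= => lt_c; rewrite /beta.
    have [le_jc | lt_cj] := leqP (part la j) c.
      have := leg_lt (_ : i < j)%N (_ : j < n)%N le_jc; have := part_mono la (_ : i <= j)%N.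
      by move=> /(_ _) H1 /(_ _ _) H2; lia.
    have := leg_ge (_ : i < j)%N (_ : j < n)%N lt_cj; have := part_mono la (_ : i <= j)%N.
    by move=> /(_ _) H1 /(_ _ _) H2; lia.
  rewrite map_inj_in_uniq ?iota_uniq // => j j'; rewrite !mem_iota => lt_j lt_j'.
  have [lt_jj' | lt_j'j | //] := ltngtP j j'.
    by have := beta_ltn n j j' lt_jj'; have := beta_ltn n i j'; lia.
  by have := beta_ltn n j' j lt_j'j; have := beta_ltn n i j; lia.
have sub_s : {subset s <= iota 1 (beta n (part la) i)}.
  move=> h; rewrite mem_cat => /orP[] /mapP[j + ->]; rewrite !mem_iota.
    have : (leg la i j <= n - i.+1)%N by rewrite -[leqRHS](size_iota i.+1) count_size.
    by rewrite /beta; lia.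
  by have := beta_ltn n i j; lia.
(* The two lists have [part la i + (n - i.+1)] entries together, which is the beta-number of row
   [i], so the inclusion is an equality. *)
have [|_ eq_s] := uniq_min_size uniq_s sub_s.
  by rewrite size_cat !size_map !size_iota /beta; lia.
by apply: uniq_perm => //; apply: iota_uniq.
Qed.

Lemma size_prod_linear (R : nzSemiRingType) (I : finType) (P : pred I) (F : I -> {poly R}) :
  (forall i, size (F i) <= 2)%N -> (size (\prod_(i | P i) F i)%R <= #|P|.+1)%N.
Proof.
move=> le2; apply: leq_trans (size_poly_prod_leq _ _) _.
have : (\sum_(i | P i) size (F i) <= #|P| * 2)%N by rewrite -sum_nat_const leq_sum.
lia.
Qed.

Section Weights.
Variables (K : fieldType) (q : K).
Hypotheses (q_neq0 : q != 0) (q_generic : forall m, (1 < m)%N -> q ^+ m != 1).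

Definition row_weight (k : nat) (c : nat -> nat) (i : nat) : K :=
  q ^+ (i * c i) * \prod_(j < k | (i < j)%N) qint q (beta k c i - beta k c j)
  / \prod_(1 <= m < (beta k c i).+1) qint q m.

(** Frobenius' form of the hook weight, for a partition [c] with at most [k] rows. *)
Definition weight (k : nat) (c : nat -> nat) : K := \prod_(i < k) row_weight k c i.

Lemma q1_neq0 : q - 1 != 0.
Proof. by rewrite subr_eq0 -(expr1 q) q_exp_neq1. Qed.

Lemma qint_neq0 m : (0 < m)%N -> qint q m != 0.
Proof. by move=> lt0m; rewrite mulf_neq0 ?invr_eq0 ?q1_neq0 // subr_eq0 q_exp_neq1. Qed.

Lemma qfact_neq0 b : \prod_(1 <= m < b) qint q m != 0.
Proof.
by rewrite prodf_seq_neq0; apply/allP => m; rewrite mem_index_iota => /andP[/qint_neq0].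
Qed.

(** By [row_hooks], the hook lengths of row [i] are the numbers from 1 to its beta-number with the
    differences to later beta-numbers left out. *)
Lemma hook_weight n (la : intpart n) :
  q ^+ nstat la * \prod_(x in diagram la) (qint q (hook_length la x))^-1
  = weight n (part la).
Proof.
rewrite /weight /row_weight; under [RHS]eq_bigr => i _ do rewrite -mulrA.
rewrite big_split /= -expr_sum; congr (_ * _).
transitivity (\prod_(i < n) \prod_(c < n | (c < part la i)%N) (qint q (part la i - c +
  leg la i c))^-1).
  rewrite pair_big_dep /=; apply: eq_big => [x | x la_x]; first by rewrite inE.
  by rewrite hook_lengthE.
apply: eq_bigr => i _.
rewrite (eq_bigr (fun j : 'I_n => qint q (beta n (part la) i - beta n (part la) j))) //.
have -> : index_iota 1 (beta n (part la) i).+1 = iota 1 (beta n (part la) i).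
  by rewrite /index_iota subSS subn0.
rewrite -(perm_big _ (row_hooks la (ltn_ord i))) big_cat !big_map /=.
have -> : iota i.+1 (n - i.+1) = index_iota i.+1 n by [].
have -> : iota 0 (part la i) = index_iota 0 (part la i) by rewrite /index_iota subn0.
rewrite (big_nat_widenl i.+1 0) // (big_nat_widen 0 (part la i) n) ?part_le //.
rewrite !big_mkord /=.
rewrite prodfV invfM mulrCA divff ?mulr1 //.
apply/prodf_neq0 => j lt_ij; apply: qint_neq0; rewrite subn_gt0.
by apply: beta_lt => //; apply: part_mono.
Qed.

Lemma eq_weight k c c' : c =1 c' -> weight k c = weight k c'.
Proof.
move=> eq_c; apply: eq_bigr => i _; rewrite /row_weight /beta eq_c.
by congr (_ * _ / _); apply: eq_bigr => j _; rewrite eq_c.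
Qed.

(** An empty row raises the earlier beta-numbers by one: each numerator gains the difference to the
    new beta-number 0, which is the factor its denominator gains. *)
Lemma weight_widen k c : c k = 0%N -> weight k.+1 c = weight k c.
Proof.
move=> ck0; rewrite /weight big_ord_recr /= [X in _ * X](_ : _ = 1); last first.
  rewrite /row_weight ck0 muln0 expr0 mul1r /beta ck0 /= subnn big_geq // divr1.
  by apply: big1 => j; rewrite ltnNge -ltnS ltn_ord.
rewrite mulr1; apply: eq_bigr => i _; rewrite /row_weight.
have betaS j : (j < k)%N -> beta k.+1 c j = (beta k c j).+1 by rewrite /beta; lia.
rewrite big_mkcond big_ord_recr -big_mkcond /= ltn_ord.
have -> : beta k.+1 c k = 0%N by rewrite /beta ck0 subnn.
rewrite betaS // subn0 big_nat_recr //=.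
rewrite (eq_bigr (fun j : 'I_k => qint q (beta k c i - beta k c j))) => [|j _]; last first.
  by rewrite betaS.
have ? := qfact_neq0 (beta k c i).+1; have ? := qint_neq0 (ltn0Sn (beta k c i)).
by field; apply/andP.
Qed.

(** The first factor is the inverse of the [q]-integer by which the denominator of row [i] grows. *)
Definition node_ratio k (c : nat -> nat) (i : 'I_k) : K :=
  (q - 1) / (q * q ^+ beta k c i - 1) *
  \prod_(j < k | j != i) ((q * q ^+ beta k c i - q ^+ beta k c j)
                          / (q ^+ beta k c i - q ^+ beta k c j)).

Lemma qintB a b : (b <= a)%N -> qint q (a - b) = (q ^+ a - q ^+ b) / (q ^+ b * (q - 1)).
Proof.
move=> leba; rewrite -[in RHS](subnK leba) exprD /qint.
have ? := q1_neq0; have ? : q ^+ b != 0 by rewrite expf_neq0.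
by field; apply/andP.
Qed.

(** Row [i] gains [q ^+ i], each of the [i] rows above it gains [q^-1], and these powers cancel; the
    rows below are unchanged. *)
Lemma weight_add_node k c c' (i : 'I_k) :
    (forall a b, (a <= b)%N -> (c b <= c a)%N) ->
    (forall j, c' j = (c j + (j == i))%N) ->
  weight k c' = weight k c * node_ratio c i.
Proof.
move=> mono c'E; have q1N0 := q1_neq0.
have beta_i : beta k c' i = (beta k c i).+1 by rewrite /beta c'E eqxx; lia.
have beta_j (j : nat) : j != i -> beta k c' j = beta k c j.
  by move=> /negPf neq_ji; rewrite /beta c'E neq_ji addn0.
pose z (j : 'I_k) := q ^+ beta k c j.
pose g (j : 'I_k) := (q * z i - z j) / (z i - z j).
have z_neq (a b : 'I_k) : (a < b)%N -> z a - z b != 0.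
  move=> lt_ab; rewrite subr_eq0 (inj_eq (q_exp_inj q_neq0 q_generic)).
  by rewrite gtn_eqF // beta_lt.
have row_i : row_weight k c' i = row_weight k c i *
    (q ^+ i * ((q - 1) / (q * z i - 1) * \prod_(j < k | (i < j)%N) g j)).
  rewrite /row_weight beta_i c'E eqxx addn1 mulnS exprD big_nat_recr //=.
  rewrite (eq_bigr (fun j : 'I_k => qint q (beta k c i - beta k c j) * g j)) => [|j lt_ij].
    have fact_neq0 := qfact_neq0 (beta k c i).+1.
    have : q * z i - 1 != 0 by rewrite subr_eq0 -exprS q_exp_neq1.
    rewrite big_split /= => zN0.
    have -> : qint q (beta k c i).+1 = (q * z i - 1) / (q - 1) by rewrite /qint exprS.
    by field; rewrite zN0 q1N0 fact_neq0.
  rewrite beta_j; last by rewrite eq_sym ltn_eqF.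
  have lt_beta := beta_lt mono lt_ij (ltn_ord j).
  rewrite !qintB ?(leqW (ltnW _)) // ?(ltnW lt_beta) // /g -/(z i) -/(z j) exprS -/(z i).
  have ? := z_neq _ _ lt_ij; have ? : z j != 0 by rewrite expf_neq0.
  by field; apply/and3P.
have row_lt (a : 'I_k) : (a < i)%N ->
    row_weight k c' a = row_weight k c a * (q^-1 * g a).
  move=> lt_ai; have neq_ai : val a != val i by rewrite ltn_eqF.
  rewrite /row_weight beta_j // c'E (negPf neq_ai) addn0.
  rewrite (bigD1 i) //= [in RHS](bigD1 i) //= beta_i.
  rewrite (eq_bigr (fun j : 'I_k => qint q (beta k c a - beta k c j))) =>
    [|j /andP[_ neq_ji]].
    have lt_beta := beta_lt mono lt_ai (ltn_ord i).
    have -> : qint q (beta k c a - (beta k c i).+1) =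
      qint q (beta k c a - beta k c i) * (q^-1 * g a).
      rewrite !qintB ?(ltnW lt_beta) // exprS /g -/(z i) -/(z a).
      have ? := z_neq _ _ lt_ai; have ? : z i - z a != 0 by rewrite -opprB oppr_eq0.
      have ? : z i != 0 by rewrite expf_neq0.
      by field; do ?[apply/andP; split].
    have ? := qfact_neq0 (beta k c a).+1.
    by field; do ?[apply/andP; split].
  by rewrite beta_j.
have row_gt (a : 'I_k) : (i < a)%N -> row_weight k c' a = row_weight k c a.
  move=> lt_ia; have neq_ai : val a != val i by rewrite gtn_eqF.
  rewrite /row_weight beta_j // c'E (negPf neq_ai) addn0; congr (_ * _ / _).
  apply: eq_bigr => j lt_aj; rewrite beta_j //.
  by rewrite gtn_eqF // (ltn_trans lt_ia).
have ratioE : node_ratio c i = (q ^+ i * ((q - 1) / (q * z i - 1) *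
  \prod_(j < k | (i < j)%N) g j))
    * \prod_(j < k | (j < i)%N) (q^-1 * g j).
  have -> : \prod_(j < k | (j < i)%N) (q^-1 * g j) =
      (q ^+ i)^-1 * \prod_(j < k | (j < i)%N) g j.
    rewrite big_split /=; congr (_ * _).
    by rewrite -(big_ord_widen k (fun=> q^-1)) ?(ltnW (ltn_ord i)) // prodr_const
      card_ord exprVn.
  have -> : node_ratio c i = (q - 1) / (q * z i - 1) * \prod_(j < k | j != i) g j by [].
  rewrite (bigID (fun j : 'I_k => (j < i)%N)) /=.
  have -> : \prod_(j < k | (j != i) && (j < i)%N) g j = \prod_(j < k | (j < i)%N) g j.
    by apply: eq_bigl => j; case: ltnP; rewrite ?andbF // andbT -val_eqE => /ltn_eqF->.
  have -> : \prod_(j < k | (j != i) && ~~ (j < i)%N) g j = \prod_(j < k | (i < j)%N) g j.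
    by apply: eq_bigl => j; rewrite -leqNgt [RHS]ltn_neqAle eq_sym -val_eqE.
  have ? : q ^+ i != 0 by rewrite expf_neq0.
  have ? : q * z i - 1 != 0 by rewrite subr_eq0 -exprS q_exp_neq1.
  by field; apply/andP.
rewrite ratioE /weight (bigD1 i) //= row_i [in RHS](bigD1 i) //=.
rewrite (_ : \prod_(a < k | a != i) row_weight k c' a =
  \prod_(a < k | a != i) row_weight k c a * \prod_(j < k | (j < i)%N) (q^-1 * g j));
    first by ring.
rewrite [X in _ = _ * X](eq_bigl (fun j : 'I_k => (j != i) && (j < i)%N)); last first.
  by move=> j; case: ltnP; rewrite ?andbF // andbT -val_eqE => /ltn_eqF->.
rewrite big_mkcondr -big_split /=; apply: eq_bigr => a; rewrite -val_eqE /=.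
by case: ltngtP => // [/row_lt | /row_gt] -> _; rewrite ?mulr1.
Qed.

(** Both identities on the weights of the partitions covering [c] are instances of
    Lagrange's: with the nodes [z i = q ^+ beta i], completed by 0 in the first case. *)
Section AddNode.
Variables (n : nat) (c : nat -> nat).
Hypotheses (mono : forall a b, (a <= b)%N -> (c b <= c a)%N) (c_n : c n = 0%N).

Let z (i : 'I_n.+1) : K := q ^+ beta n.+1 c i.

Lemma node_inj : injective z.
Proof.
move=> i j /(q_exp_inj q_neq0 q_generic); have [lt_ij | lt_ji | /val_inj //] := ltngtP i j.
  by move=> eq_b; have := beta_lt mono lt_ij (ltn_ord j); rewrite eq_b ltnn.
by move=> eq_b; have := beta_lt mono lt_ji (ltn_ord i); rewrite eq_b ltnn.
Qed.

Lemma node_neq0 i : z i != 0.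
Proof. exact: expf_neq0. Qed.

Lemma node_last : z ord_max = 1.
Proof. by rewrite /z /beta /= c_n subnn. Qed.

(** Where no node fits, [q * z i] equals the value of [z] in the row above. This lets sums over
    addable rows run over all rows. *)
Lemma node_ratio_eq0 (i : 'I_n.+1) : ~~ ((i == 0%N :> nat) || (c i < c i.-1)%N) ->
  node_ratio c i = 0.
Proof.
case/norP=> i_neq0; rewrite -leqNgt => no_i; have lt0i : (0 < i)%N by rewrite lt0n.
have lt_i1 : (i.-1 < n.+1)%N by rewrite prednK // ltnW.
have c_i : c i = c i.-1 by apply/eqP; rewrite eqn_leq no_i mono ?leq_pred.
rewrite /node_ratio (bigD1 (Ordinal lt_i1)) /=;
  last by rewrite -val_eqE /= ltn_eqF // prednK.
rewrite -exprS [q ^+ _.+1](_ : _ = q ^+ beta n.+1 c i.-1) ?subrr ?mul0r ?mulr0 //.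
by rewrite /beta /= c_i; congr (q ^+ _); have := ltn_ord i; lia.
Qed.

(** The last row is empty with [z] equal to 1, so [q * z i - 1] is one of the factors
    [q * z i - z j]; the factor for [j = i] supplies [(q - 1) * z i]. *)
Lemma node_ratioE (i : 'I_n.+1) :
  node_ratio c i = \prod_(j < n) (q * z i - z (widen_ord (leqnSn n) j))
                   / (z i * \prod_(j < n.+1 | j != i) (z i - z j)).
Proof.
have qz1 : q * z i - 1 != 0 by rewrite subr_eq0 -exprS q_exp_neq1.
have zN0 := node_neq0 i; have q1N0 := q1_neq0.
have prodN0 : \prod_(j < n.+1 | j != i) (z i - z j) != 0.
  by apply/prodf_neq0 => j neq_ji; rewrite subr_eq0 (inj_eq node_inj) eq_sym.
have eq_all : (q * z i - z i) * \prod_(j < n.+1 | j != i) (q * z i - z j)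
    = \prod_(j < n) (q * z i - z (widen_ord (leqnSn n) j)) * (q * z i - 1).
  transitivity (\prod_(j < n.+1) (q * z i - z j)); first by rewrite [RHS](bigD1 i).
  by rewrite big_ord_recr node_last.
rewrite /node_ratio prodf_div -/(z i).
apply: (mulIf qz1); rewrite [RHS]mulrAC -eq_all; field.
by rewrite prodN0 zN0 qz1.
Qed.

Let factor (j : 'I_n) : {poly K} := q *: 'X - (z (widen_ord (leqnSn n) j))%:P.

Lemma size_factor j : (size (factor j) <= 2)%N.
Proof.
apply: leq_trans (size_polyD _ _) _; rewrite size_polyN geq_max.
rewrite (leq_trans (size_scale_leq _ _)) ?size_polyX //.
by rewrite (leq_trans (size_polyC_leq1 _)).
Qed.

Lemma sum_node_ratio : \sum_(i < n.+1) node_ratio c i = 1.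
Proof.
(* The extra node 0 produces the factor [z i] in the denominator of [node_ratioE], and its own term
   is -1. *)
pose x (i : 'I_n.+2) : K := if insub (val i) is Some j then z j else 0.
have x_inj : injective x.
  move=> i j; rewrite /x; case: insubP => [i' _ eq_i|ge_i];
    case: insubP => [j' _ eq_j|ge_j].
  - by move/node_inj => eq_ij; apply: val_inj; rewrite -eq_i -eq_j eq_ij.
  - by move=> z0; have := node_neq0 i'; rewrite z0 eqxx.
  - by move=> z0; have := node_neq0 j'; rewrite -z0 eqxx.
  move=> _; apply: val_inj => /=; have := ltn_ord i; have := ltn_ord j.
  by rewrite /= in ge_i ge_j; lia.
have xE (j : 'I_n.+1) : x (widen_ord (leqnSn _) j) = z j.
  by rewrite /x /= valK.
have x_max : x ord_max = 0 by rewrite /x insubF //= ltnn.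
pose p := \prod_(j < n) factor j.
have p_val y : p.[y] = \prod_(j < n) (q * y - z (widen_ord (leqnSn n) j)).
  by rewrite horner_prod; apply: eq_bigr => j _; rewrite !hornerE.
have szp : (size p <= n.+1)%N.
  by rewrite (leq_trans (size_prod_linear _ size_factor)) // cardT size_enum_ord.
have := lagrange_sum x_inj szp; rewrite big_ord_recr /= x_max p_val.
have -> : \prod_(j < n.+2 | j != ord_max) (0 - x j) =
  - \prod_(j < n) (q * 0 - z (widen_ord (leqnSn n) j)).
  rewrite big_mkcond big_ord_recr /= eqxx mulr1.
  rewrite (eq_bigr (fun j => 0 - z j)) => [|j _]; last first.
    by rewrite -val_eqE /= ltn_eqF // xE.
  by rewrite big_ord_recr node_last /= mulr0 sub0r mulrN1.
rewrite invrN mulrN divff; last first.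
  apply/prodf_neq0 => j _; rewrite mulr0 sub0r oppr_eq0; exact: node_neq0.
move/eqP; rewrite subr_eq0 => /eqP <-; apply: eq_bigr => i _.
rewrite xE p_val node_ratioE; congr (_ / _).
rewrite [RHS]big_mkcond big_ord_recr /= x_max subr0 -val_eqE /= gtn_eqF // mulrC.
rewrite big_mkcond; congr (_ * _); apply: eq_bigr => j _.
by rewrite xE.
Qed.

Lemma sum_node_ratio_contents (b : 'I_n) : (c b.+1 < c b)%N ->
  \sum_(i < n.+1 | (i == 0%N :> nat) || (c i < c i.-1)%N)
    node_ratio c i * z i / (q * z i - z (widen_ord (leqnSn n) b)) = 0.
Proof.
move=> corner; pose p := \prod_(j < n | j != b) factor j.
have szp : (size p <= n)%N.
  rewrite (leq_trans (size_prod_linear _ size_factor)) // (cardC1 b) card_ord prednK //.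
  exact: leq_ltn_trans (ltn_ord b).
have p_val y : p.[y] = \prod_(j < n | j != b) (q * y - z (widen_ord (leqnSn n) j)).
  by rewrite horner_prod; apply: eq_bigr => j _; rewrite !hornerE.
rewrite -[RHS](lagrange_sum node_inj szp) big_mkcond /=; apply: eq_bigr => i _.
rewrite p_val; case: ifP => [add_i | /negbT/norP[i_neq0]].
  have qzN0 : q * z i - z (widen_ord (leqnSn n) b) != 0.
    (* The beta-numbers of [i] and [b] never differ by exactly one in this direction: row [b] ends
       in a corner, so for [i] below [b] the gap is at least 2. *)
    rewrite subr_eq0 -exprS (inj_eq (q_exp_inj q_neq0 q_generic)) /beta /=.
    apply/eqP; have lt_bn := ltn_ord b; have le_in := ltn_ord i.
    case: (leqP i b) => [le_ib | lt_bi]; first by have := mono le_ib; lia.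
    by have := mono lt_bi; lia.
  rewrite node_ratioE (bigD1 b) //=; have zN0 := node_neq0 i.
  have prodN0 : \prod_(j < n.+1 | j != i) (z i - z j) != 0.
    by apply/prodf_neq0 => j neq_ji; rewrite subr_eq0 (inj_eq node_inj) eq_sym.
  by field; rewrite prodN0 zN0 qzN0.
rewrite -leqNgt => no_i; have lt0i : (0 < i)%N by rewrite lt0n.
have lt_i1 : (i.-1 < n)%N by rewrite prednK // -ltnS ltn_ord.
have c_i : c i = c i.-1 by apply/eqP; rewrite eqn_leq no_i mono ?leq_pred.
(* Row [i.-1] is as long as row [i] and so has no corner, unlike [b]; its factor is present in [p]
   and vanishes at [z i]. *)
have neq_b : Ordinal lt_i1 != b.
  by apply: contraTneq corner => <- /=; rewrite prednK // c_i ltnn.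
rewrite (bigD1 (Ordinal lt_i1)) //= -exprS [q ^+ _](_ : _ =
  z (widen_ord (leqnSn n) (Ordinal lt_i1))).
  by rewrite subrr !mul0r.
by rewrite /z /beta /= c_i; congr (q ^+ _); have := ltn_ord i; lia.
Qed.

End AddNode.
End Weights.

(** * The weighted sum of the characters *)

Section WeightedTrace.
Variables (K : fieldType) (q : K).
Hypotheses (q_neq0 : q != 0) (q_generic : forall m, (1 < m)%N -> q ^+ m != 1).

Definition word_weight (t : seq nat) : K := weight q (size t) (fun i => count_mem i t).

Lemma word_weight_swap k t : word_weight (swap_box k t) = word_weight t.
Proof.
by rewrite /word_weight size_swap_box; apply: eq_weight => i; rewrite count_swap_box.
Qed.

Lemma word_weight_shape n (la : intpart n) t : t \in std_of la ->
  word_weight t = weight q n (part la).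
Proof.
case/std_ofP=> /[!mem_std_words]/andP[_ /eqP szt] cnt_t.
by rewrite /word_weight szt; apply: eq_weight.
Qed.

Section Covers.
Variables (n : nat) (t : seq nat).
Hypothesis St : t \in std_words n.

Let c i := count_mem i t.

Lemma covers_mono a b : (a <= b)%N -> (c b <= c a)%N.
Proof. by apply: std_word_mono; move: St; rewrite mem_std_words => /andP[]. Qed.

Lemma covers_last : c n = 0%N.
Proof. exact: (std_words_count St). Qed.

Lemma word_weight_cons (i : 'I_n.+1) : word_weight (val i :: t) =
  word_weight t * node_ratio q c i.
Proof.
have /[!mem_std_words]/andP[_ /eqP szt] := St.
rewrite /word_weight /= szt -(weight_widen q_neq0 q_generic covers_last).
apply: (weight_add_node q_neq0 q_generic covers_mono) => j.
by rewrite addnC eq_sym.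
Qed.

Lemma sum_addable (V : nmodType) (F : nat -> V) :
  \sum_(i <- addable t) F i = \sum_(i < n.+1 | (i == 0%N :> nat) || (c i < c i.-1)%N) F i.
Proof.
have /[!mem_std_words]/andP[_ /eqP szt] := St.
by rewrite big_filter szt -[iota 0 n.+1]/(index_iota 0 n.+1) big_mkord.
Qed.

Lemma sum_word_weight : \sum_(i <- addable t) word_weight (i :: t) = word_weight t.
Proof.
rewrite sum_addable (eq_bigr _ (fun i _ => word_weight_cons i)) -mulr_sumr.
rewrite -[RHS]mulr1 -(sum_node_ratio q_neq0 q_generic covers_mono covers_last).
congr (_ * _); rewrite big_mkcond; apply: eq_bigr => i _; case: ifP => // /negbT no_i.
by rewrite (node_ratio_eq0 q_neq0 covers_mono covers_last no_i).
Qed.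

(** Up to the common factor [q ^+ n], [z i] is [x], [q] to the content of the new node, and [z b] is
    [q * y] for the corner; so [diag_coef q y x] is [(q - 1) * q] times [z i / (q * z i - z b)]. *)
Lemma sum_word_weight_diag b r : t = b :: r ->
  \sum_(i <- addable t)
    word_weight (i :: t) * diag_coef q (content q b r) (content q i t) = 0.
Proof.
move=> t_br; have /[!mem_std_words]/andP[std_t /eqP szt] := St.
have lt_bn : (b < n)%N by rewrite -szt (std_word_lt std_t) // t_br mem_head.
have corner : (c b.+1 < c b)%N.
  have std_r : std_word r by move: std_t; rewrite t_br => /andP[].
  rewrite /c t_br /= eqxx (ltn_eqF (ltnSn b)) add0n add1n ltnS.
  exact: std_word_mono.
have c_b : c b = (count_mem b r).+1 by rewrite /c t_br /= eqxx.
rewrite -[RHS](mulr0 (word_weight t * ((q - 1) * q))).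
rewrite -[X in _ = _ * X](sum_node_ratio_contents q_neq0 q_generic covers_mono
  covers_last (b := Ordinal lt_bn) corner).
rewrite mulr_sumr.
rewrite sum_addable; apply: eq_bigr => i _; rewrite word_weight_cons.
have contE : q ^+ beta n.+1 c i = content q i t * q ^+ n.
  have le_in : (i <= n)%N by rewrite -ltnS.
  rewrite /beta /content /= exprD;
    have <- : q ^+ i * q ^+ (n - i) = q ^+ n by rewrite -exprD subnKC.
  by have ? : q ^+ i != 0; [rewrite expf_neq0 | field].
have contE_b : q ^+ beta n.+1 c b = q * (content q b r * q ^+ n).
  rewrite /beta c_b /content /= addSn exprS exprD.
  have <- : q ^+ b * q ^+ (n - b) = q ^+ n by rewrite -exprD subnKC // ltnW.
  by have ? : q ^+ b != 0; [rewrite expf_neq0 | field].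
rewrite /= contE contE_b /diag_coef -mulrBr -mulrBl !invfM.
have ? : q ^+ n != 0 by rewrite expf_neq0.
set d := (_ - _)^-1; by field; apply/andP.
Qed.

End Covers.

Definition weighted_trace (n : nat) (u : seq nat) : K :=
  \sum_(t <- std_words n) word_weight t * thetas q u (delta K t) t.

Lemma thetas_eq n u f g s : size s = n ->
  (forall r, size r = n -> f r = g r) -> thetas q u f s = thetas q u g s.
Proof.
move=> + eq_fg; elim: u s => [|k u IHu] s szs /=; first exact: eq_fg.
by apply: (theta_eq _ _ szs).
Qed.

Lemma thetas_scale a u f s : thetas q u (fun r => a * f r) s = a * thetas q u f s.
Proof.
elim: u s => //= k u IHu s; rewrite /theta !IHu.
by ring.
Qed.

Lemma thetas_weight u f s :
  thetas q u (fun r => word_weight r * f r) s = word_weight s * thetas q u f s.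
Proof.
elim: u s => //= k u IHu s; rewrite /theta !IHu word_weight_swap.
by ring.
Qed.

Lemma thetas_cat u v f s : thetas q (u ++ v) f s = thetas q u (thetas q v f) s.
Proof. by rewrite /thetas foldr_cat. Qed.

(** The weight depends only on the shape and so commutes with the action, by [thetas_weight]; the
    usual cyclicity of a trace remains. *)
Lemma weighted_trace_catC n u v :
    all (fun k => (k.+1 < n)%N) u -> all (fun k => (k.+1 < n)%N) v ->
  weighted_trace n (u ++ v) = weighted_trace n (v ++ u).
Proof.
move=> all_u all_v; have stS := std_words_stable q_neq0 q_generic n.
have expand u' v' : all (fun k => (k.+1 < n)%N) u' -> weighted_trace n (u' ++ v') =
    \sum_(t <- std_words n) \sum_(r <- std_words n)
      word_weight t * (thetas q u' (delta K r) t * thetas q v' (delta K t) r).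
  move=> all_u'; apply: eq_big_seq => t St.
  by rewrite thetas_cat (thetas_sum _ stS) // mulr_sumr.
rewrite !expand // exchange_big /=; apply: eq_bigr => r _; apply: eq_bigr => t _.
rewrite mulrA -thetas_weight.
rewrite (@thetas_ext _ q u _ (fun s => word_weight r * delta K r s)); last first.
  by move=> s; rewrite /delta; case: eqP => [-> | _]; rewrite ?mulr0.
by rewrite thetas_scale -!mulrA [X in _ * X]mulrC.
Qed.

Lemma weighted_trace_restrict n u : all (fun k => (k.+1 < n)%N) u ->
  weighted_trace n.+1 u = weighted_trace n u.
Proof.
move=> all_u; rewrite /weighted_trace sum_std_wordsS; apply: eq_big_seq => s Ss.
have /[!mem_std_words]/andP[_ /eqP szs] := Ss.
rewrite -(sum_word_weight Ss) mulr_suml; apply: eq_bigr => i _.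
rewrite (thetas_cons _ _ _ szs) //; congr (_ * _); apply: thetas_ext => r.
by rewrite /delta eqseq_cons eqxx.
Qed.

(** The word [u] keeps the last box in place, so only the diagonal entry of the top generator
    reaches the trace. The entry of [u] does not depend on the last box and factors out of the sum
    over it. *)
Lemma weighted_trace_last n u : all (fun k => (k < n)%N) u ->
  weighted_trace n.+2 (u ++ [:: n]) = 0.
Proof.
move=> all_u; rewrite /weighted_trace sum_std_wordsS big_seq big1 // => t St.
have /[!mem_std_words]/andP[_ /eqP szt] := St.
case: t St szt => // j t St [szt].
transitivity (thetas q u (delta K (j :: t)) (j :: t) * \sum_(i <- addable (j :: t))
    word_weight (i :: j :: t) * diag_coef q (content q j t) (content q i (j :: t))).
  rewrite mulr_sumr; apply: eq_bigr => i _.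
  rewrite [RHS]mulrCA; congr (_ * _); rewrite [RHS]mulrC -thetas_scale thetas_cat.
  rewrite (@thetas_cons _ q n.+1) /= ?szt //.
  apply: (@thetas_eq n.+1); first by rewrite /= szt.
  move=> [|j' r] // [szr].
  rewrite /theta swap_box_head // box_cons /= ?szr // !eqxx /delta.
  have -> : ([:: j', i & r] == [:: i, j & t]) = (j' == i) && (i :: r == j :: t) by [].
  rewrite (eqseq_cons i) eqxx /=.
  have [[-> ->] | neq_r] := eqVneq (j' :: r) (j :: t).
    have [-> | neq_ji] := eqVneq j i; last by rewrite mulr0 addr0.
    (* For [j = i] the swap fixes the word, but the two boxes are neighbours in a row and the guard
       makes the coefficient 0. *)
    have horiz : q * content q i t == content q i (i :: t).
      by rewrite content_mulq //= eqxx; lia.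
    by rewrite /swap_coef horiz !mul0r addr0.
  rewrite [_ && _](_ : _ = false) ?mulr0 ?addr0 //.
  by apply: contraNF neq_r => /andP[/eqP-> /eqP->].
by rewrite (sum_word_weight_diag St (erefl _)) mulr0.
Qed.

(** If the last run is empty, the word restricts to the smaller size; otherwise the rest of the run
    is moved cyclically to the front, leaving the top generator last. *)
Lemma weighted_trace_normal N v : v \in normal_words N ->
  weighted_trace N.+1 v = (v == [::])%:R.
Proof.
elim: N v => [|N IHN] v.
  rewrite inE => /eqP->; rewrite /weighted_trace /= !big_seq1 /thetas /= /delta eqxx mulr1.
  have := @sum_word_weight 0 [::] isT; rewrite big_seq1 => ->.
  by rewrite /word_weight /weight big_ord0.
case/normal_wordsSP=> u [j [Nu lejN ->]]; have all_u := normal_words_lt Nu.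
move: lejN; rewrite leq_eqVlt => /predU1P[-> | lejN].
  by rewrite descent_nil cats0 weighted_trace_restrict // IHN.
rewrite descent_cons // -cat1s catA weighted_trace_catC.
- rewrite catA weighted_trace_last //.
    by case: u {Nu all_u}.
  rewrite all_cat all_u andbT; apply/allP=> k; rewrite mem_rev mem_iota; lia.
- rewrite all_cat /= ltnSn !andbT; by apply/allP=> k /(allP all_u); apply: ltnW.
by apply/allP=> k; rewrite mem_rev mem_iota; lia.
Qed.

End WeightedTrace.

Theorem proposition7 (K : closedFieldType) (charK : [pchar K] =i pred0)
    (q : K) (q_neq0 : q != 0)
    (q_generic : forall m : nat, (1 < m)%N -> q ^+ m != 1)
    (H : forall n : nat, heckeAlgebra q n)
    (chi : forall n : nat, intpart n -> H n -> K)
    (chiP : standard_labelling chi)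
    (n : nat) (n_gt0 : (0 < n)%N) :
  (forall (la : intpart n) (E : H n),
     primitive_idempotent E -> corresponds chi E la ->
     hecke_trace E
     = q ^+ nstat la * \prod_(x in diagram la) (qint q (hook_length la x))^-1)
  /\
  (forall h : H n,
     hecke_trace h
     = \sum_(la : intpart n)
         (q ^+ nstat la * \prod_(x in diagram la) (qint q (hook_length la x))^-1)
         * chi n la h).
Proof.
suff traceE (h : H n) : hecke_trace h = \sum_(la : intpart n)
    (q ^+ nstat la * \prod_(x in diagram la) (qint q (hook_length la x))^-1) * chi n la h.
  split=> // la E _ corrE; rewrite traceE (bigD1 la) //= corrE eqxx mulr1 [X in _ +
    X]big1 ?addr0 // => mu.
  by rewrite corrE eq_sym => /negPf->; rewrite mulr0.
case: n n_gt0 h => // N _ h.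
have chiE (la : intpart N.+1) : chi _ la h =
    \sum_(w : 'S_N.+1) hecke_coef w h * std_char q la (normal_word w).
  have [d [rho aff]] := std_of_affords q_neq0 q_generic (H N.+1) la.
  rewrite (labelling_shape q_neq0 q_generic chiP aff) {1}(hecke_expand h) !linear_sum /=.
  apply: eq_bigr => w _; rewrite !linearZ /= (affords_trace aff) //.
  by have [Nw _] := normal_wordP w; apply: normal_words_lt.
have traceE : hecke_trace h = \sum_(w : 'S_N.+1) hecke_coef w h *
  (normal_word w == [::])%:R.
  rewrite {1}(hecke_expand h) /hecke_trace /hecke_coef linear_sum; apply: eq_bigr => w _.
  have [Nw _] := normal_wordP w; rewrite linearZ /=; congr (_ * _).
  exact: (hecke_trace_normal (H N.+1) Nw).
rewrite traceE; under [RHS]eq_bigr => la _ do rewrite hook_weight // chiE mulr_sumr.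
rewrite exchange_big /=; apply: eq_bigr => w _; have [Nw _] := normal_wordP w.
rewrite -(weighted_trace_normal q_neq0 q_generic Nw) /weighted_trace sum_std_words
  mulr_sumr.
apply: eq_bigr => la _; rewrite mulrCA; congr (_ * _); rewrite mulr_sumr.
by apply: eq_big_seq => t la_t; rewrite (word_weight_shape q la_t).
Qed.
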